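(* Let $W$ be any finite irreducible Weyl group and $\widetilde{W}$ the corresponding affine Weyl group, with segments, canonical factorizations $r(w)$, allowed pairs and the set $\mathcal{P}$ of affine colored partitions as described in the context. For $w\in\widetilde{W}^S$ with canonical factorization $r(w)=\sigma^{c_f}(\lambda_f)\cdots\sigma^{c_2}(\lambda_2)\sigma^{c_1}(\lambda_1)$ put $\pi(w)=(\lambda_1^{c_1},\lambda_2^{c_2},\dots,\lambda_f^{c_f})$ (and $\pi(\mathrm{id})=\emptyset$). Then $\pi(w)\in\mathcal{P}$ for every $w\in\widetilde{W}^S$, and $\pi:\widetilde{W}^S\to\mathcal{P}$ is a bijection satisfying $\sum_t\lambda_t=\ell(w)$, i.e. it is length preserving.
   Context: $\widetilde{W}$ is the Coxeter group with generators $s_0,s_1,\dots,s_n$ given by the standard affine Dynkin diagram, labelled as follows ($m(s,s')=2$ for non-adjacent nodes, $3$ for a single bond, $4$ for a double bond, $6$ for a triple bond): $\widetilde{A}_n$ ($n\ge2$): cycle $s_0-s_1-\cdots-s_n-s_0$; $\widetilde{A}_1$: $m(s_0,s_1)=\infty$; $\widetilde{B}_n$ ($n\ge3$): $s_0$ and $s_1$ each joined to $s_2$, path $s_2-\cdots-s_n$ with a double bond between $s_{n-1},s_n$; $\widetilde{C}_n$ ($n\ge2$): path $s_0-s_1-\cdots-s_n$ with double bonds $s_0s_1$ and $s_{n-1}s_n$; $\widetilde{D}_n$ ($n\ge4$): $s_0,s_1$ joined to $s_2$, path $s_2-\cdots-s_{n-2}$, and $s_{n-1},s_n$ both joined to $s_{n-2}$;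 $\widetilde{E}_6$: path $s_0-s_1-s_2-s_3-s_4$ and path $s_2-s_5-s_6$; $\widetilde{E}_7$: path $s_0-\cdots-s_6$ and $s_3-s_7$; $\widetilde{E}_8$: path $s_0-\cdots-s_7$ and $s_5-s_8$; $\widetilde{F}_4$: path $s_0-s_1-s_2-s_3-s_4$ with a double bond between $s_2,s_3$; $\widetilde{G}_2$: path $s_0-s_1-s_2$ with a triple bond between $s_1,s_2$. Let $S=\{s_1,\dots,s_n\}$, so $W=W_S$. For a subset $I$ of generators, $W_I$ is the parabolic subgroup, $W^I$ (or $\widetilde{W}^I$) the set of minimal length representatives of left cosets $wW_I$, and every $w$ factors uniquely as $w=u_I(w)v_I(w)$ with $u_I(w)$ minimal in its coset, $v_I(w)\in W_I$, $\ell(w)=\ell(u_I(w))+\ell(v_I(w))$. Type I (types $A,C,E,F,G$): let $J=\{s\in S: ss_0=s_0s\}$. For each $j\ge0$ list the elements of $W^J$ of length $j$ as $f_1(j),\dots,f_k(j)$ (fixing a reduced word for each) and define the segment $\sigma^i(j+1)=f_i(j)s_0\in\widetilde{W}^S$; the superscript $i$ is the color. For $w\in\widetilde{W}^S$, $w\neq\mathrm{id}$, put $w'=ws_0$; then $v_S(w')=f_i(j)$ for some $i,j$, $w=u_S(w')\sigma^i(j+1)$ with $u_S(w')\in\widetilde{W}^S$, and recursively $r(w)=r(u_S(w'))\,\sigma^i(j+1)$, $r(\mathrm{id})$ empty. A pair $(i^a,j^b)$ is allowed if $\sigma^a(i)\sigma^b(j)\in\widetilde{W}^S$ and $\ell(\sigma^a(i)\sigma^b(j))=i+j$.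 Type II (types $B,D$): let $J=\{s_2,\dots,s_n\}$, $S'=\{s_0,s_2,\dots,s_n\}$. The 1-segments $\sigma_1^i(j)$ are the elements of $W_S^J$ of length $j$, and the 0-segments $\sigma_0^i(j)$ the elements of $(W_{S'})^J$ of length $j$, colored compatibly (the $0$-segment of color $i$ and length $j$ is the image of the $1$-segment of color $i$ and length $j$ under a fixed diagram automorphism interchanging $s_0,s_1$ and preserving $J$). For $w\in\widetilde{W}^S$, $w\ne\mathrm{id}$: $v_{S'}(w)$ is a 0-segment $\sigma_0^{c_1}(\lambda_1)$ and $u_1=u_{S'}(w)\in\widetilde{W}^{S'}$; if $u_1\ne\mathrm{id}$, $v_S(u_1)$ is a 1-segment $\sigma_1^{c_2}(\lambda_2)$ and $u_2=u_S(u_1)\in\widetilde{W}^S$; continue alternately until reaching the identity, giving $r(w)=\cdots\sigma_0^{c_3}(\lambda_3)\sigma_1^{c_2}(\lambda_2)\sigma_0^{c_1}(\lambda_1)$ (written without the subscripts $0,1$ in the claim). A pair $(i^a,j^b)$ is allowed if $\sigma_1^a(i)\sigma_0^b(j)\in\widetilde{W}^S$ and has length $i+j$. A colored partition is a finite sequence $(\lambda_1^{c_1},\dots,\lambda_f^{c_f})$ of positive integers $\lambda_1\ge\cdots\ge\lambda_f$ with colors such that each $\sigma^{c_t}(\lambda_t)$ is a segment. $\mathcal{P}$ is the set of colored partitions (including the empty one) such that $(\lambda_{t+1}^{c_{t+1}},\lambda_t^{c_t})$ is an allowed pair for all $1\le t<f$. *)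

(* Defs.v *)
From HB Require Import structures.
From mathcomp Require Import all_boot all_fingroup.
From mathcomp Require Import generic_quotient.
From mathcomp Require Import boolp classical_sets functions.
Set Implicit Arguments.
Unset Strict Implicit.
Unset Printing Implicit Defensive.

Local Open Scope quotient_scope.
Local Open Scope classical_set_scope.
Local Open Scope group_scope.

(** * Coxeter groups *)

(* Congruence on words generated by s_i^2 = 1 and (s_i s_j)^(M i j) = 1.
   The value M i j = 0 encodes m(s_i, s_j) = oo: the relation is then void. *)
Inductive cox_cong (I : finType) (M : I -> I -> nat) : seq I -> seq I -> Prop :=
| cox_cong_refl u : cox_cong M u u
| cox_cong_sym u v : cox_cong M u v -> cox_cong M v u
| cox_cong_trans u v w : cox_cong M u v -> cox_cong M v w -> cox_cong M u w
| cox_cong_cat u u' v v' :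
    cox_cong M u u' -> cox_cong M v v' -> cox_cong M (u ++ v) (u' ++ v')
| cox_cong_sqr i : cox_cong M [:: i; i] [::]
| cox_cong_rel i j : cox_cong M (flatten (nseq (M i j) [:: i; j])) [::].

Definition cox_eqb (I : finType) (M : I -> I -> nat) : rel (seq I) :=
  fun u v => `[< cox_cong M u v >].

Lemma cox_eqb_equiv (I : finType) (M : I -> I -> nat) :
  equiv_class_of (cox_eqb M).
Proof.
split=> [u | u v | v u w /asboolP uv /asboolP vw].
- by apply/asboolP; apply: cox_cong_refl.
- by apply/asboolP/asboolP; apply: cox_cong_sym.
- by apply/asboolP; apply: cox_cong_trans vw.
Qed.

Canonical cox_equiv (I : finType) (M : I -> I -> nat) :=
  EquivRelPack (cox_eqb_equiv M).

Definition coxgroup (I : finType) (M : I -> I -> nat) : Type :=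
  {eq_quot cox_equiv M}.

HB.instance Definition _ (I : finType) (M : I -> I -> nat) :=
  EqQuotient.on (coxgroup M).
HB.instance Definition _ (I : finType) (M : I -> I -> nat) :=
  Choice.on (coxgroup M).

Definition cox_word (I : finType) (M : I -> I -> nat) (u : seq I) : coxgroup M :=
  \pi_(coxgroup M) u.

Lemma cox_wordP (I : finType) (M : I -> I -> nat) (u v : seq I) :
  cox_word M u = cox_word M v <-> cox_cong M u v.
Proof.
split=> [uv | uv]; last by apply/eqP; rewrite /cox_word piE; apply/asboolP.
by apply/asboolP; move/eqP: uv; rewrite /cox_word piE.
Qed.

Lemma cox_wordK (I : finType) (M : I -> I -> nat) (x : coxgroup M) :
  cox_word M (repr x) = x.
Proof. exact: reprK. Qed.

Definition cox_mul (I : finType) (M : I -> I -> nat) (x y : coxgroup M) :=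
  cox_word M (repr x ++ repr y).
Definition cox_inv (I : finType) (M : I -> I -> nat) (x : coxgroup M) :=
  cox_word M (rev (repr x)).

Lemma cox_mulE (I : finType) (M : I -> I -> nat) (u v : seq I) :
  cox_mul (cox_word M u) (cox_word M v) = cox_word M (u ++ v).
Proof. by apply/cox_wordP; apply: cox_cong_cat; apply/cox_wordP/cox_wordK. Qed.

Lemma cox_cong_rev (I : finType) (M : I -> I -> nat) (u : seq I) :
  cox_cong M (u ++ rev u) [::].
Proof.
elim: u => [|i u IHu]; first exact: cox_cong_refl.
rewrite rev_cons -cats1 /= catA -cat_cons -cat1s -catA.
apply: cox_cong_trans (cox_cong_sqr M i); rewrite -[[:: i; i]]/([:: i] ++ ([::] ++ [:: i])).
apply: cox_cong_cat (cox_cong_refl _ _) _.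
exact: cox_cong_cat IHu (cox_cong_refl _ _).
Qed.

Lemma cox_mulA (I : finType) (M : I -> I -> nat) : associative (@cox_mul I M).
Proof.
move=> x y z; rewrite -(cox_wordK x) -(cox_wordK y) -(cox_wordK z).
by rewrite !cox_mulE catA.
Qed.

Lemma cox_mul1 (I : finType) (M : I -> I -> nat) :
  left_id (cox_word M [::]) (@cox_mul I M).
Proof. by move=> x; rewrite -(cox_wordK x) cox_mulE. Qed.

Lemma cox_mulr1 (I : finType) (M : I -> I -> nat) :
  right_id (cox_word M [::]) (@cox_mul I M).
Proof. by move=> x; rewrite -(cox_wordK x) cox_mulE cats0. Qed.

Lemma cox_mulV (I : finType) (M : I -> I -> nat) :
  left_inverse (cox_word M [::]) (@cox_inv I M) (@cox_mul I M).
Proof.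
move=> x; rewrite -{2}(cox_wordK x) cox_mulE; apply/cox_wordP.
by rewrite -{2}(revK (repr x)); apply: cox_cong_rev.
Qed.

Lemma cox_mulrV (I : finType) (M : I -> I -> nat) :
  right_inverse (cox_word M [::]) (@cox_inv I M) (@cox_mul I M).
Proof.
by move=> x; rewrite -{1}(cox_wordK x) cox_mulE; apply/cox_wordP/cox_cong_rev.
Qed.

HB.instance Definition _ (I : finType) (M : I -> I -> nat) :=
  isGroup.Build (coxgroup M) (@cox_mulA I M) (@cox_mul1 I M) (@cox_mulr1 I M)
    (@cox_mulV I M) (@cox_mulrV I M).

Definition cox_gen (I : finType) (M : I -> I -> nat) (i : I) : coxgroup M :=
  cox_word M [:: i].

Lemma cox_prodE (I : finType) (M : I -> I -> nat) (u : seq I) :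
  \prod_(i <- u) cox_gen M i = cox_word M u.
Proof.
elim: u => [|i u IHu]; first by rewrite big_nil.
by rewrite big_cons IHu; apply: cox_mulE.
Qed.

Definition cox_has_word (I : finType) (M : I -> I -> nat) (x : coxgroup M) :
    pred nat :=
  fun k => [exists t : k.-tuple I, \prod_(i <- t) cox_gen M i == x].

Lemma cox_has_wordP (I : finType) (M : I -> I -> nat) (x : coxgroup M) :
  exists k, cox_has_word x k.
Proof.
exists (size (repr x)); apply/existsP; exists (in_tuple (repr x)).
by rewrite cox_prodE cox_wordK.
Qed.

Definition cox_len (I : finType) (M : I -> I -> nat) (x : coxgroup M) : nat :=
  ex_minn (cox_has_wordP x).

Definition parabolic (I : finType) (M : I -> I -> nat) (K : pred I) :
    set (coxgroup M) :=
  [set x | exists2 u : seq I, all K u & x = \prod_(i <- u) cox_gen M i].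
Arguments parabolic {I} M K.

(* Minimal length representatives of the left cosets x W_K. *)
Definition min_rep (I : finType) (M : I -> I -> nat) (K : pred I) :
    set (coxgroup M) :=
  [set x | forall y, parabolic M K y -> (cox_len x <= cox_len (x * y)%g)%N].
Arguments min_rep {I} M K.

(* The pair (u_K(x), v_K(x)). *)
Definition par_fact (I : finType) (M : I -> I -> nat) (K : pred I)
    (x : coxgroup M) : coxgroup M * coxgroup M :=
  xget (1, 1) [set p | [/\ min_rep M K p.1, parabolic M K p.2, x = p.1 * p.2
                         & cox_len x = (cox_len p.1 + cox_len p.2)%N]].
Definition u_part (I : finType) (M : I -> I -> nat) (K : pred I)
    (x : coxgroup M) := (par_fact K x).1.
Definition v_part (I : finType) (M : I -> I -> nat) (K : pred I)
    (x : coxgroup M) := (par_fact K x).2.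

Definition diagram_aut (I : finType) (M : I -> I -> nat) (th : {perm I}) : Prop :=
  forall i j, M (th i) (th j) = M i j.

(* Computed on an arbitrary word for x; when th is a diagram automorphism this
   is the group morphism extending s_i |-> s_(th i): see cox_mapE, cox_mapM. *)
Definition cox_map (I : finType) (M : I -> I -> nat) (th : {perm I})
    (x : coxgroup M) : coxgroup M :=
  \prod_(i <- repr x) cox_gen M (th i).

Lemma cox_mapE (I : finType) (M : I -> I -> nat) (th : {perm I}) (u : seq I) :
  diagram_aut M th ->
  cox_map th (cox_word M u) = \prod_(i <- u) cox_gen M (th i).
Proof.
move=> thM; rewrite /cox_map; have /cox_wordP := cox_wordK (cox_word M u).
move: (repr _) => v.
elim=> {u v} [//| u v _ -> // | u v w _ -> _ -> // | u u' v v' _ e1 _ e2 | i | i j].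
- by rewrite !big_cat e1 e2.
- rewrite big_nil -(big_map th xpredT (cox_gen M)) cox_prodE.
  by apply/cox_wordP; apply: cox_cong_sqr.
- rewrite big_nil -(big_map th xpredT (cox_gen M)) cox_prodE.
  rewrite map_flatten map_nseq /= -thM.
  by apply/cox_wordP; apply: cox_cong_rel.
Qed.

Lemma cox_mapM (I : finType) (M : I -> I -> nat) (th : {perm I}) :
  diagram_aut M th -> {morph @cox_map I M th : x y / x * y}.
Proof.
move=> thM x y; rewrite -(cox_wordK x) -(cox_wordK y).
by rewrite [_ * _]cox_mulE !cox_mapE // big_cat.
Qed.

(** * Affine Dynkin diagrams *)

Inductive affine_type :=
| affA of nat | affB of nat | affC of nat | affD of nat
| affE6 | affE7 | affE8 | affF4 | affG2.

Definition affine_ok (X : affine_type) : bool :=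
  match X with
  | affA n => 1 <= n | affB n => 3 <= n | affC n => 2 <= n | affD n => 4 <= n
  | _ => true
  end%N.

Definition affine_rank (X : affine_type) : nat :=
  match X with
  | affA n | affB n | affC n | affD n => n
  | affE6 => 6 | affE7 => 7 | affE8 => 8 | affF4 => 4 | affG2 => 2
  end.

Definition is_typeII (X : affine_type) : bool :=
  match X with affB _ | affD _ => true | _ => false end.

(* The simple bonds of the path s_a - ... - s_b. *)
Definition simple_path (a b : nat) : seq (nat * nat * nat) :=
  [seq (i, i.+1, 3) | i <- iota a (b - a)].

(* (i, j, m) is a bond between s_i and s_j with m(s_i, s_j) = m; m = 0 is oo. *)
Definition affine_bonds (X : affine_type) : seq (nat * nat * nat) :=
  match X with
  | affA 1 => [:: (0, 1, 0)]
  | affA n => (n, 0, 3) :: simple_path 0 n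
  | affB n => [:: (0, 2, 3), (1, 2, 3), (n.-1, n, 4) & simple_path 2 n.-1]
  | affC n => [:: (0, 1, 4), (n.-1, n, 4) & simple_path 1 n.-1]
  | affD n => [:: (0, 2, 3), (1, 2, 3), (n.-2, n.-1, 3), (n.-2, n, 3)
                & simple_path 2 n.-2]
  | affE6 => [:: (2, 5, 3), (5, 6, 3) & simple_path 0 4]
  | affE7 => (3, 7, 3) :: simple_path 0 6
  | affE8 => (5, 8, 3) :: simple_path 0 7
  | affF4 => [:: (0, 1, 3); (1, 2, 3); (2, 3, 4); (3, 4, 3)]
  | affG2 => [:: (0, 1, 3); (1, 2, 6)]
  end%N.

Definition affine_cox (X : affine_type) (i j : 'I_(affine_rank X).+1) : nat :=
  if i == j then 1%N else
  head 2%N [seq b.2 | b <- affine_bonds X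
                    & (b.1 == (i : nat, j : nat)) || (b.1 == (j : nat, i : nat))].

Notation affW X := (coxgroup (@affine_cox X)).

Definition aff_s (X : affine_type) (i : 'I_(affine_rank X).+1) : affW X :=
  cox_gen (@affine_cox X) i.
Definition aff_s0 (X : affine_type) : affW X := aff_s ord0.

(* Subsets of generators are given by their indices. *)
Definition S_ X : pred 'I_(affine_rank X).+1 := fun i => (0 < i)%N.
Definition S'_ X : pred 'I_(affine_rank X).+1 := fun i => i != 1%N :> nat.
Definition J1_ X : pred 'I_(affine_rank X).+1 :=
  fun i => S_ i && (aff_s i * aff_s0 X == aff_s0 X * aff_s i).
Definition J2_ X : pred 'I_(affine_rank X).+1 := fun i => (1 < i)%N.

Definition affWS X : set (affW X) := min_rep (@affine_cox X) (@S_ X).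

(** * Colored parts, segments and factorizations *)

(* A part lambda^c is the pair (lambda, c); colors are numbered from 1. *)
Definition cpart : Type := (nat * nat)%type.

(* The list f j enumerates the elements of A of length j; its c-th entry is
   f_c(j). *)
Definition enum_by_length X (A : set (affW X)) (f : nat -> seq (affW X)) : Prop :=
  forall j, uniq (f j) /\ forall x, x \in f j <-> A x /\ cox_len x = j.

Definition f_ X (f : nat -> seq (affW X)) (c j : nat) : affW X :=
  nth 1 (f j) c.-1.

Definition color_of X (s : seq (affW X)) (x : affW X) : nat := (index x s).+1.

Definition colored_partition (is_seg : cpart -> Prop) (p : seq cpart) : Prop :=
  [/\ forall a, a \in p -> (0 < a.1)%N, sorted geq [seq a.1 | a <- p]
    & forall a, a \in p -> is_seg a].

Definition affine_partitions (is_seg : cpart -> Prop)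
    (allowed : cpart -> cpart -> Prop) : set (seq cpart) :=
  [set p | colored_partition is_seg p /\
     forall t, (t.+1 < size p)%N ->
       allowed (nth (0, 0)%N p t.+1) (nth (0, 0)%N p t)].

(** ** Type I *)

Definition enumI X (f : nat -> seq (affW X)) : Prop :=
  enum_by_length
    (parabolic (@affine_cox X) (@S_ X) `&` min_rep (@affine_cox X) (@J1_ X)) f.

Definition is_segI X (f : nat -> seq (affW X)) (a : cpart) : Prop :=
  (0 < a.1)%N /\ (0 < a.2 <= size (f a.1.-1))%N.

Definition segI X (f : nat -> seq (affW X)) (a : cpart) : affW X :=
  f_ f a.2 a.1.-1 * aff_s0 X.

Definition allowedI X (f : nat -> seq (affW X)) (a b : cpart) : Prop :=
  affWS (segI f a * segI f b) /\
  cox_len (segI f a * segI f b) = (a.1 + b.1)%N.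

(* The canonical factorization r(w), read from its rightmost factor. For w <> 1
   in the domain, u_S(w s_0) is strictly shorter than w, so that k = cox_len w
   steps of the recursion reach the identity. *)
Fixpoint factI X (f : nat -> seq (affW X)) (k : nat) (w : affW X) : seq cpart :=
  if k isn't k'.+1 then [::] else
  if w == 1 then [::] else
  let w' := w * aff_s0 X in
  let v := v_part (@S_ X) w' in
  let j := cox_len v in
  (j.+1, color_of (f j) v) :: factI f k' (u_part (@S_ X) w').

Definition piI X (f : nat -> seq (affW X)) (w : affW X) : seq cpart :=
  factI f (cox_len w) w.

Definition partsI X (f : nat -> seq (affW X)) : set (seq cpart) :=
  affine_partitions (is_segI f) (allowedI f).

(** ** Type II *)

Definition enumII X (f : nat -> seq (affW X)) : Prop :=
  enum_by_length
    (parabolic (@affine_cox X) (@S_ X) `&` min_rep (@affine_cox X) (@J2_ X)) f.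

Definition swap_aut X (th : {perm 'I_(affine_rank X).+1}) : Prop :=
  [/\ diagram_aut (@affine_cox X) th,
      th ord0 = 1%N :> nat,
      forall i : 'I_(affine_rank X).+1, i = 1%N :> nat -> th i = ord0
    & forall i, J2_ (th i) = J2_ i].

Definition is_segII X (f : nat -> seq (affW X)) (a : cpart) : Prop :=
  (0 < a.2 <= size (f a.1))%N.

(* b = true gives the 1-segments, b = false the 0-segments. *)
Definition segsII X (f : nat -> seq (affW X)) (th : {perm 'I_(affine_rank X).+1})
    (b : bool) (j : nat) : seq (affW X) :=
  if b then f j else [seq cox_map th x | x <- f j].

Definition segII X (f : nat -> seq (affW X)) (th : {perm 'I_(affine_rank X).+1})
    (b : bool) (a : cpart) : affW X :=
  f_ (segsII f th b) a.2 a.1.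

Definition allowedII X (f : nat -> seq (affW X))
    (th : {perm 'I_(affine_rank X).+1}) (a b : cpart) : Prop :=
  affWS (segII f th true a * segII f th false b) /\
  cox_len (segII f th true a * segII f th false b) = (a.1 + b.1)%N.

(* As factI; b tells whether the next factor to be split off on the right is a
   1-segment (w is then minimal for S') or a 0-segment (w is minimal for S). *)
Fixpoint factII X (f : nat -> seq (affW X)) (th : {perm 'I_(affine_rank X).+1})
    (k : nat) (b : bool) (w : affW X) : seq cpart :=
  if k isn't k'.+1 then [::] else
  if w == 1 then [::] else
  let K := if b then @S_ X else @S'_ X in
  let v := v_part K w in
  let j := cox_len v in
  (j, color_of (segsII f th b j) v) :: factII f th k' (~~ b) (u_part K w).

Definition piII X (f : nat -> seq (affW X)) (th : {perm 'I_(affine_rank X).+1})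
    (w : affW X) : seq cpart :=
  factII f th (cox_len w) false w.

Definition partsII X (f : nat -> seq (affW X))
    (th : {perm 'I_(affine_rank X).+1}) : set (seq cpart) :=
  affine_partitions (is_segII f) (allowedII f th).

(* Main.v *)
(** Both families of segments are instances of one recursion. Let phi be right
    multiplication by s_0 (Type I) or the diagram automorphism (Type II); every
    w <> 1 in W~^S is phi (u f) with u = u_S (phi w) in W~^S and f = v_S (phi w)
    in W^J. Let Theta be the highest root (Type I) or twice the minuscule
    coweight fixed by J (Type II), and grade the finite roots by their pairing
    with the coroot of Theta. For u in W~^S the bad roots, i.e. the finite roots
    mu with u (delta - mu) < 0, form an upper order ideal, and phi (u f) lies in
    W~^S with additive length iff f maps no root of positive degree to a bad
    root of u.

    If u = phi (u' f2), then u and phi f2 have the same bad roots in positive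
    degree. A bad root mu of u of degree 0 that pairs positively with f1 Theta
    lies below a root of degree 1 with the same property, so that it suffices to
    test bad roots of positive degree: pairwise allowed segments multiply to an
    element of W~^S. Finally, if (f2, f1) is allowed, the inversions of f2
    correspond to bad roots mu of phi f2; sending mu to itself if it pairs
    negatively with f1 Theta, and otherwise to mu - kappa for a suitable root
    kappa pairing positively with both Theta and f1 Theta, injects them into the
    inversions of f1, whence l(f2) <= l(f1).

    Everything takes place in the root lattice Z^(n+1) of the untwisted affine
    root system, on which the Coxeter group acts by reflections. *)

From HB Require Import structures.
Require Import Defs.
From mathcomp Require Import all_boot all_order all_fingroup all_algebra.
From mathcomp Require Import boolp classical_sets functions.
From mathcomp Require Import ring zify generic_quotient.
Set Implicit Arguments.
Unset Strict Implicit.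
Unset Printing Implicit Defensive.
Import Order.TTheory GRing.Theory Num.Theory.

(** * Length in Coxeter groups *)

(** The obstacle is locality. An allowed pair involves two neighbouring factors only, whereas
    membership of a product in W~^S depends, through bad roots of degree 0, on all earlier factors.
    Degree 1 is local because u in W~^S preserves the sign of every finite root and so drops out of
    the test on [phi (u f)].

    In Type II the coweight is doubled so that [deg top = 2] in both types; the reflection in [top]
    then sends x of degree 1 to [x - top]. The norm of [top] is 2 r kap, with r the ratio of squared
    root lengths, and comparing norms leaves few positions of f1 Theta relative to Theta: equal,
    opposite, orthogonal, or degree 1 or -1, the last only in Type I. Both the lifting of bad roots
    from degree 0 to 1 and the comparison of lengths run over these positions. *)

Section Length.
Variables (I : finType) (M : I -> I -> nat).
Implicit Types (x y : coxgroup M) (i : I) (u : seq I).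
Local Open Scope group_scope.
Local Notation s := (cox_gen M).
Local Notation len := (@cox_len I M).

Lemma cox_word_cat u v : cox_word M (u ++ v) = cox_word M u * cox_word M v.
Proof. by rewrite -!cox_prodE big_cat. Qed.

Lemma cox_word_rcons u i : cox_word M (rcons u i) = cox_word M u * s i.
Proof. by rewrite -cats1 cox_word_cat. Qed.

Lemma cox_word0 : cox_word M [::] = 1. Proof. by []. Qed.

Lemma cox_genK i : s i * s i = 1.
Proof. by rewrite -cox_word_cat; apply/cox_wordP; exact: cox_cong_sqr. Qed.

Lemma cox_len_le u : (len (cox_word M u) <= size u)%N.
Proof.
rewrite /cox_len; case: ex_minnP => k _; apply.
by apply/existsP; exists (in_tuple u); rewrite cox_prodE.
Qed.

Lemma cox_len_word x : {u | cox_word M u = x & size u = len x}.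
Proof.
rewrite /cox_len; case: ex_minnP => k /existsP/sigW[t /eqP tx] _.
by exists t; rewrite ?size_tuple // -cox_prodE.
Qed.

Lemma cox_len1 : len 1 = 0%N.
Proof. by apply/eqP; rewrite -leqn0 (cox_len_le [::]). Qed.

Lemma cox_len_eq0 x : len x = 0%N -> x = 1.
Proof. by case: (cox_len_word x) => u <- <- /size0nil ->. Qed.

(** All relators have even length, so parity is an invariant of the group element; hence a generator
    cannot preserve the length. *)
Lemma cox_cong_odd u v : cox_cong M u v -> odd (size u) = odd (size v).
Proof.
elim=> {u v} // [u v w _ -> _ -> // | u u' v v' _ e1 _ e2 | i j].
  by rewrite !size_cat !oddD e1 e2.
rewrite size_flatten /shape map_nseq sumn_nseq /=.
by rewrite oddM.
Qed.

Lemma odd_cox_len_word u : odd (len (cox_word M u)) = odd (size u).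
Proof.
by case: (cox_len_word (cox_word M u)) => v /cox_wordP/cox_cong_odd <- <-.
Qed.

Lemma cox_len_mul_le x y : (len (x * y)%g <= len x + len y)%N.
Proof.
case: (cox_len_word x) (cox_len_word y) => u <- <- [v <- <-].
by rewrite -cox_word_cat -size_cat cox_len_le.
Qed.

Lemma cox_len_gen_le x i : (len (x * s i)%g <= (len x).+1)%N.
Proof. by rewrite (leq_trans (cox_len_mul_le _ _)) // -addn1 leq_add2l cox_len_le. Qed.

Lemma cox_mulgenK x i : x * s i * s i = x.
Proof. by rewrite -mulgA cox_genK mulg1. Qed.

Lemma cox_len_genP x i :
  len (x * s i) = (len x).+1 \/ len x = (len (x * s i)%g).+1.
Proof.
have le1 := cox_len_gen_le x i; have := cox_len_gen_le (x * s i) i.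
rewrite cox_mulgenK => le2.
have : odd (len (x * s i)) = ~~ odd (len x).
  by rewrite -(cox_wordK x) -cox_word_rcons !odd_cox_len_word size_rcons.
by move=> od; have := erefl (odd (len x)); lia.
Qed.

Lemma cox_last x : x <> 1 -> exists i, len x = (len (x * s i)%g).+1.
Proof.
case: (cox_len_word x) => u xu; case/lastP: u xu => [<- //|u i xu szu _].
exists i; have := cox_len_genP x i; have := cox_len_le u.
have -> : x * s i = cox_word M u by rewrite -xu cox_word_rcons cox_mulgenK.
by move: szu; rewrite size_rcons; lia.
Qed.

End Length.

(** * Alternating words and cosets of rank two parabolic subgroups *)

Section Alternating.
Variables (I : finType) (M : I -> I -> nat).
Local Open Scope group_scope.

Fixpoint alt (i j : I) (k : nat) : seq I :=
  if k is k'.+1 then rcons (alt j i k') j else [::].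

Lemma size_alt i j k : size (alt i j k) = k.
Proof. by elim: k i j => //= k IH i j; rewrite size_rcons IH. Qed.

Lemma alt_cat i j l k : exists2 s, size s = l & alt i j (l + k) = s ++ alt i j k.
Proof.
elim: k i j => [|k IH] i j.
  by exists (alt i j l); rewrite ?size_alt ?addn0 ?cats0.
by have [s ss e] := IH j i; exists s; rewrite // addnS /= e rcons_cat.
Qed.

(** Right descents [j], [i], [j], ... are stripped as long as they occur. A descent just removed is
    no longer one, so the hypothesis passes to the shorter element with [i] and [j] exchanged. *)
Lemma cox_alt_strip (x : coxgroup M) i j :
  (cox_len x < cox_len (x * cox_gen M i)%g)%N ->
  exists k y, [/\ x = y * cox_word M (alt i j k), cox_len x = (cox_len y + k)%N,
    (cox_len y < cox_len (y * cox_gen M i)%g)%N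
    & (cox_len y < cox_len (y * cox_gen M j)%g)%N].
Proof.
move: {2}(cox_len x) (leqnn (cox_len x)) => b.
elim: b x i j => [|b IHb] x i j le_xb lt_xi.
  exists 0%N, x; split; rewrite ?cox_word0 ?mulg1 ?addn0 //.
  by have := cox_len_genP x j; lia.
have [lt_xj|eq_xj] : (cox_len x < cox_len (x * cox_gen M j)%g)%N \/
    cox_len x = (cox_len (x * cox_gen M j)%g).+1.
  by have := cox_len_genP x j; lia.
  by exists 0%N, x; split; rewrite ?cox_word0 ?mulg1 ?addn0.
have [|//|k [y [xy lxy lyj lyi]]] := IHb (x * cox_gen M j) j i; first lia.
  by rewrite cox_mulgenK; lia.
exists k.+1, y; split=> //=; last by lia.
by rewrite cox_word_rcons mulgA -xy cox_mulgenK.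
Qed.

End Alternating.

Local Open Scope ring_scope.

(** * The reflection representation *)

(** The product of the two Cartan integers is 4 cos^2(pi/m); the last entry is the bond of affine
    A_1, where m is infinite. *)
Definition bond_ok (m : nat) (x y : int) : bool :=
  (m, x, y) \in [:: (2%N, 0, 0); (3%N, -1, -1); (4%N, -1, -2); (4%N, -2, -1);
                    (6%N, -1, -3); (6%N, -3, -1); (0%N, -2, -2)].

(* [cart] is an untwisted affine Cartan matrix, [hsq i] half the squared length
   of the simple root i, scaled so that short roots have [hsq = 1], and [mark]
   the coordinates of the null root. *)
Record affine_datum (n : nat) (M : 'I_n.+1 -> 'I_n.+1 -> nat) := AffineDatum {
  cart : 'I_n.+1 -> 'I_n.+1 -> int;
  hsq : 'I_n.+1 -> int;
  mark : 'I_n.+1 -> int;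
  sqratio : int;
  cart_diag : forall i, cart i i = 2;
  cart_sym : forall i j, hsq i * cart i j = hsq j * cart j i;
  cart_bond : forall i j, i != j -> bond_ok (M i j) (cart i j) (cart j i);
  cart_conn : forall P : 'I_n.+1 -> Prop,
    (forall i j, cart i j != 0 -> P i -> P j) -> forall i j, P i -> P j;
  sqratio_gt0 : 0 < sqratio;
  hsqP : forall i, hsq i = 1 \/ hsq i = sqratio;
  mark_gt0 : forall i, 0 < mark i;
  mark0 : mark ord0 = 1;
  mark_null : forall i, \sum_j cart i j * mark j = 0;
  mark_dvd : forall i, (sqratio %| hsq i * mark i)%Z
}.

Section Representation.
Variables (n : nat) (M : 'I_n.+1 -> 'I_n.+1 -> nat) (C : affine_datum M).
Local Notation I := 'I_n.+1.
Local Notation V := 'rV[int]_n.+1.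
Local Notation a := (cart C).
Local Notation d := (hsq C).
Local Notation r := (sqratio C).
Local Notation G := (coxgroup M).
Implicit Types (i j : I) (v x y : V) (u w : G).

Definition sroot i : V := delta_mx 0 i.
Definition copair i v : int := \sum_j a i j * v 0 j.
Definition refl i v : V := v - copair i v *: sroot i.

Lemma copairE i v : copair i v = \sum_j a i j * v 0 j. Proof. by []. Qed.
Lemma reflE i v : refl i v = v - copair i v *: sroot i. Proof. by []. Qed.

Lemma srootE i j : sroot i 0 j = (i == j)%:R.
Proof. by rewrite mxE eqxx eq_sym. Qed.

Lemma copair_is_linear i c x y : copair i (c *: x + y) = c * copair i x + copair i y.
Proof.
rewrite mulr_sumr -big_split; apply: eq_bigr => j _ /=; rewrite !mxE; ring.
Qed.

Lemma copair_sroot i j : copair i (sroot j) = a i j.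
Proof.
rewrite /copair (bigD1 j) //= srootE eqxx mulr1 big1 ?addr0 // => k.
by rewrite srootE eq_sym => /negbTE ->; rewrite mulr0.
Qed.

Lemma refl_is_linear i : linear (refl i).
Proof.
move=> c x y; rewrite /refl copair_is_linear; apply/rowP => j; rewrite !mxE; ring.
Qed.
HB.instance Definition _ i :=
  GRing.isLinear.Build int V V *:%R (refl i) (refl_is_linear i).

Lemma copairD i x y : copair i (x + y) = copair i x + copair i y.
Proof. by rewrite -{1}[x]scale1r copair_is_linear mul1r. Qed.
Lemma copairZ i c x : copair i (c *: x) = c * copair i x.
Proof.
by rewrite mulr_sumr; apply: eq_bigr => j _; rewrite !mxE; ring.
Qed.

Lemma reflK i : involutive (refl i).
Proof.
move=> v; rewrite /refl -scaleNr copairD copairZ copair_sroot cart_diag.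
by apply/rowP => j; rewrite !mxE; ring.
Qed.

Definition actw (s : seq I) v : V := foldr refl v s.

Lemma actw_is_linear s : linear (actw s).
Proof. by elim: s => [|i s IH] c x y //=; rewrite IH linearP. Qed.
HB.instance Definition _ s :=
  GRing.isLinear.Build int V V *:%R (actw s) (actw_is_linear s).

Lemma actw_cat s t v : actw (s ++ t) v = actw s (actw t v).
Proof. exact: foldr_cat. Qed.

(* The orbit of v under s_i s_j stays in v + Z alpha_i + Z alpha_j; the four
   coefficients express the coordinates in terms of [copair i v, copair j v]. *)
Definition rot_step (q p : int) (c : int * int * int * int) :=
  let: (x1, y1, x2, y2) := c in
  let x2' := - x2 - p * x1 in let y2' := - 1 - y2 - p * y1 in
  (- 1 - x1 - q * x2', - y1 - q * y2', x2', y2').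

Lemma actw_rot i j k v :
  let: (x1, y1, x2, y2) := iter k (rot_step (a i j) (a j i)) (0, 0, 0, 0) in
  actw (flatten (nseq k [:: i; j])) v =
  v + (x1 * copair i v + y1 * copair j v) *: sroot i
    + (x2 * copair i v + y2 * copair j v) *: sroot j.
Proof.
elim: k => [|k] /=; first by rewrite !mul0r !addr0 !scale0r !addr0.
case: (iter k _ _) => [[[x1 y1] x2] y2] /= ->.
rewrite /refl !(copairD, copairZ, copair_sroot, cart_diag) -!scaleNr.
rewrite !(copairD, copairZ, copair_sroot, cart_diag).
by apply/rowP => l; rewrite !mxE; ring.
Qed.

Lemma actw_rel i j v : actw (flatten (nseq (M i j) [:: i; j])) v = v.
Proof.
have [<-|ij] := eqVneq i j.
  by elim: (M i i) => //= k IH; rewrite IH reflK.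
(* For each possible bond the recursion runs on numerals, and its coefficients are back at zero
   after [M i j] steps. *)
have := actw_rot i j (M i j) v.
have := cart_bond C ij; rewrite /bond_ok !inE.
by do 6?[case/orP]; case/eqP => -> -> -> /= ->;
  rewrite !mul0r !addr0 !scale0r !addr0.
Qed.

Lemma actw_cong s t : cox_cong M s t -> forall v, actw s v = actw t v.
Proof.
elim=> {s t} // [s t p _ e1 _ e2 v | s s' t t' _ e1 _ e2 v | i v | i j v].
- by rewrite e1 e2.
- by rewrite !actw_cat e1 e2.
- exact: reflK.
- exact: actw_rel.
Qed.

Definition cox_act w v : V := actw (repr w) v.

HB.instance Definition _ w :=
  GRing.isLinear.Build int V V *:%R (cox_act w) (actw_is_linear (repr w)).

Local Notation act := cox_act.

Lemma cox_act_word s v : act (cox_word M s) v = actw s v.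
Proof. by apply: actw_cong; apply/cox_wordP; rewrite cox_wordK. Qed.

Lemma cox_actM u w v : act (u * w)%g v = act u (act w v).
Proof. by rewrite -(cox_wordK u) -(cox_wordK w) -cox_word_cat !cox_act_word actw_cat. Qed.

Lemma cox_act1 v : act 1%g v = v. Proof. exact: (cox_act_word [::]). Qed.

Lemma cox_act_gen i v : act (cox_gen M i) v = refl i v.
Proof. exact: cox_act_word. Qed.

Lemma cox_actK w : cancel (act w) (act w^-1%g).
Proof. by move=> v; rewrite -cox_actM mulVg cox_act1. Qed.
Lemma cox_actVK w : cancel (act w^-1%g) (act w).
Proof. by move=> v; rewrite -cox_actM mulgV cox_act1. Qed.

Definition vpos v : Prop := forall i, 0 <= v 0 i.

Lemma vposD x y : vpos x -> vpos y -> vpos (x + y).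
Proof. by move=> px py i; rewrite !mxE addr_ge0. Qed.
Lemma vposZ c x : 0 <= c -> vpos x -> vpos (c *: x).
Proof. by move=> c0 px i; rewrite !mxE mulr_ge0. Qed.
Lemma vpos_sroot i : vpos (sroot i).
Proof. by move=> j; rewrite srootE; case: eqP. Qed.
Lemma vpos_anti x : vpos x -> vpos (- x) -> x = 0.
Proof.
move=> px nx; apply/rowP => i; rewrite [RHS]mxE; apply/eqP; rewrite eq_le px andbT.
by have := nx i; rewrite mxE oppr_ge0.
Qed.

Lemma alt_invM i j k :
  ((cox_word M (alt i j k))^-1 * cox_word M (alt j i k) =
   (cox_gen M j * cox_gen M i) ^+ k)%g.
Proof.
elim: k i j => [|k IH] i j; first by rewrite expg0 invg1 mulg1.
rewrite /= !cox_word_rcons invgM -mulgA (mulgA (cox_word M (alt j i k))^-1%g) IH.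
have -> : ((cox_gen M j)^-1 = cox_gen M j)%g by apply: mulg1_eq; exact: cox_genK.
elim: k {IH} => [|k IH]; first by rewrite !expg0 expg1 mul1g.
by rewrite expgS (expgS _ k.+1) -IH !mulgA.
Qed.

Lemma cox_braid i j : cox_word M (alt i j (M i j)) = cox_word M (alt j i (M i j)).
Proof.
apply: (@mulgI _ (cox_word M (alt i j (M i j)))^-1%g).
rewrite mulVg alt_invM; apply: invg_inj; rewrite invg1 -expVgn invgM.
have gV k : ((cox_gen M k)^-1 = cox_gen M k)%g.
  by apply: mulg1_eq; exact: cox_genK.
rewrite !gV; symmetry.
have <- : cox_word M (flatten (nseq (M i j) [:: i; j])) = 1%g.
  by apply/cox_wordP; exact: cox_cong_rel.
elim: (M i j) => [|k IH] //=.
rewrite expgS IH -cat1s (cox_word_cat M [:: i]) -[j :: _]cat1s.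
by rewrite (cox_word_cat M [:: j]) mulgA.
Qed.

(* The coordinates of [actw (alt i j k) (X *: sroot i + Y *: sroot j)], where
   p = a j i and q = a i j. *)
Fixpoint alt_coord (k : nat) (p q X Y : int) : int * int :=
  if k is k'.+1 then
    let: (Y', X') := alt_coord k' q p (- Y - p * X) X in (X', Y')
  else (X, Y).

Lemma actw_alt i j k X Y :
  actw (alt i j k) (X *: sroot i + Y *: sroot j) =
  let: (X', Y') := alt_coord k (a j i) (a i j) X Y in X' *: sroot i + Y' *: sroot j.
Proof.
elim: k i j X Y => //= k IH i j X Y; rewrite -cats1 actw_cat /=.
have -> : refl j (X *: sroot i + Y *: sroot j) =
    (- Y - a j i * X) *: sroot j + X *: sroot i.
  rewrite /refl !(copairD, copairZ, copair_sroot, cart_diag).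
  by apply/rowP => l; rewrite !mxE; ring.
by rewrite IH; case: (alt_coord _ _ _ _ _) => X' Y'; rewrite addrC.
Qed.

(** A step sends (X, Y) to (2X - Y, X), which again satisfies 0 <= Y < X. *)
Lemma alt_coord_infinite k X Y : Y < X -> 0 <= Y ->
  0 <= (alt_coord k (-2) (-2) X Y).1 /\ 0 <= (alt_coord k (-2) (-2) X Y).2.
Proof.
elim: k X Y => [|k IH] X Y YX Y0 /=; first by split; lia.
have [|//|] := IH (- Y - -2 * X) X; [lia | lia |].
by case: (alt_coord _ _ _ _ _) => X' Y' /=.
Qed.

(** Rank two case of [cox_len_pos]: an alternating word that ends in j and is shorter than the
    longest one keeps alpha_i positive. Each finite bond is a computation. *)
Lemma alt_coord_ge0 i j k : i != j -> (k < M i j)%N \/ M i j = 0%N ->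
  0 <= (alt_coord k (a j i) (a i j) 1 0).1 /\
  0 <= (alt_coord k (a j i) (a i j) 1 0).2.
Proof.
move=> ij; have := cart_bond C ij; rewrite /bond_ok !inE.
do 6?[case/orP]; case/eqP => -> -> ->; case=> //;
  try by case: k => [|[|[|[|[|[|k]]]]]].
by move=> _; exact: alt_coord_infinite.
Qed.

(** Strip from w a dihedral factor ending in a descent j. What remains is shorter and ascends at
    both i and j, and the dihedral factor takes alpha_i to a nonnegative combination of alpha_i and
    alpha_j. *)
Theorem cox_len_pos w i :
  (cox_len w < cox_len (w * cox_gen M i)%g)%N -> vpos (act w (sroot i)).
Proof.
move: {2}(cox_len w) (leqnn (cox_len w)) => b.
elim: b w i => [|b IHb] w i le_wb lt_wi.
  have -> : w = 1%g by apply: cox_len_eq0; lia.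
  by rewrite cox_act1; exact: vpos_sroot.
have [w1|/eqP/cox_last[j wj]] := eqVneq w 1%g.
  by rewrite w1 cox_act1; exact: vpos_sroot.
have ij : i != j by apply: contraTneq lt_wi => ->; lia.
have [k [y [wy lwy yi yj]]] := cox_alt_strip j lt_wi.
have lt_yw : (cox_len y < cox_len w)%N.
  case: k wy lwy => [|k] wy lwy; last by lia.
  by move: wy; rewrite mulg1 => wy; move: yj; rewrite -wy wj; lia.
have le_yb : (cox_len y <= b)%N by lia.
rewrite wy cox_actM cox_act_word; have := actw_alt i j k 1 0.
rewrite scale1r scale0r addr0 => ->.
have [|] := @alt_coord_ge0 i j k ij.
  have [->|Mpos] := posnP (M i j); [by right|left].
  (* If k reached [M i j], the braid relation would make the word end in i, and [w s_i] would be
     shorter than w. *)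
  rewrite ltnNge; apply/negP => le_Mk.
  have [s ss] := alt_cat i j (k - M i j) (M i j); rewrite subnK // => e.
  move: wy lt_wi; rewrite e cox_word_cat cox_braid.
  case: (M i j) Mpos ss le_Mk e => // m _ ss le_Mk _ wy.
  rewrite {2}wy /= cox_word_rcons !mulgA cox_mulgenK -mulgA -cox_word_cat.
  have := cox_len_mul_le y (cox_word M (s ++ alt i j m)).
  have := cox_len_le M (s ++ alt i j m).
  rewrite size_cat size_alt ss => h1 h2 h3.
  have := leq_trans h3 (leq_trans h2 (leq_add (leqnn _) h1)).
  by rewrite lwy ltn_add2l; lia.
case: (alt_coord _ _ _ _ _) => X Y /= X0 Y0.
rewrite linearD !linearZ; apply: vposD; apply: vposZ => //; exact: IHb.
Qed.

End Representation.

(** * Parabolic factorizations *)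

Section Parabolic.
Variables (n : nat) (M : 'I_n.+1 -> 'I_n.+1 -> nat) (C : affine_datum M).
Local Notation I := 'I_n.+1.
Local Notation V := 'rV[int]_n.+1.
Local Notation G := (coxgroup M).
Local Notation act := (@cox_act n M C).
Local Notation s := (cox_gen M).
Implicit Types (i j : I) (K : pred I) (v : V) (u w y : G).

Lemma act_gen_sroot w i : act (w * s i)%g (sroot i) = - act w (sroot i).
Proof.
rewrite cox_actM cox_act_gen; have -> : refl C i (sroot i) = - sroot i.
  by rewrite /refl copair_sroot cart_diag; apply/rowP => k; rewrite !mxE; ring.
exact: linearN.
Qed.

Lemma cox_len_neg w i :
  (cox_len (w * s i)%g < cox_len w)%N -> vpos (- act w (sroot i)).
Proof.
move=> lt; rewrite -act_gen_sroot; apply: cox_len_pos.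
by rewrite (@cox_mulgenK _ M).
Qed.

Lemma act_sroot_neq0 w i : act w (sroot i) <> 0.
Proof.
move=> e; have := cox_actK C w (sroot i); rewrite e linear0 => /rowP/(_ i).
by rewrite srootE eqxx mxE.
Qed.

Lemma cox_len_mulgen_pos w i :
  vpos (act w (sroot i)) -> cox_len (w * s i)%g = (cox_len w).+1.
Proof.
move=> pw; have [//|e] := cox_len_genP w i.
case: (act_sroot_neq0 (w := w) (i := i)); apply: vpos_anti => //.
by apply: cox_len_neg; rewrite -e.
Qed.

Lemma cox_len_mulgen_neg w i :
  vpos (- act w (sroot i)) -> cox_len w = (cox_len (w * s i)%g).+1.
Proof.
move=> pw; have [e|//] := cox_len_genP w i.
case: (act_sroot_neq0 (w := w) (i := i)); apply: vpos_anti => //.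
by apply: cox_len_pos; rewrite e.
Qed.

Lemma act_sroot_sign w i : vpos (act w (sroot i)) \/ vpos (- act w (sroot i)).
Proof.
have [e|e] := cox_len_genP w i; [left; apply: cox_len_pos|right; apply: cox_len_neg].
  by rewrite e.
by rewrite -e.
Qed.

Lemma cox_no_descent w : (forall i, vpos (act w (sroot i))) -> w = 1%g.
Proof.
move=> pw; have [//|/eqP/cox_last[i]] := eqVneq w 1%g.
by rewrite cox_len_mulgen_pos //; lia.
Qed.

Definition supported K v : Prop := forall i, ~~ K i -> v 0 i = 0.

Lemma supported_sroot K i : K i -> supported K (sroot i).
Proof. by move=> Ki j; rewrite srootE; case: eqP => // <-; rewrite Ki. Qed.

Lemma sum_sroot v : v = \sum_i v 0 i *: sroot i.
Proof. exact: row_sum_delta. Qed.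

Lemma act_pos_comb K w v : (forall k, K k -> vpos (act w (sroot k))) ->
  vpos v -> supported K v -> vpos (act w v).
Proof.
move=> pw pv sv; rewrite [v]sum_sroot linear_sum /=.
elim/big_ind: _ => [|x y|k _]; first by move=> i; rewrite mxE.
  exact: vposD.
rewrite linearZ /=; case Kk: (K k); first by apply: vposZ => //; apply: pw.
by rewrite sv ?Kk // scale0r => i; rewrite mxE.
Qed.

Lemma parabolicM K u w : parabolic M K u -> parabolic M K w ->
  parabolic M K (u * w)%g.
Proof.
move=> [p Kp ->] [q Kq ->]; exists (p ++ q); last by rewrite big_cat.
by rewrite all_cat Kp.
Qed.

Lemma parabolic_gen K k : K k -> parabolic M K (s k).
Proof. by move=> Kk; exists [:: k]; rewrite /= ?Kk ?big_seq1. Qed.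

Lemma parabolic1 K : parabolic M K 1%g.
Proof. by exists [::]; rewrite ?big_nil. Qed.

Lemma parabolic_ind K (P : G -> Prop) : P 1%g ->
  (forall w k, parabolic M K w -> K k -> P w -> P (w * s k)%g) ->
  forall w, parabolic M K w -> P w.
Proof.
move=> P1 PM w [p + ->]; elim/last_ind: p => [_|p k IH]; first by rewrite big_nil.
rewrite all_rcons => /andP[Kk Kp]; rewrite -cats1 big_cat big_seq1.
by apply: PM => //; [exists p | exact: IH].
Qed.

Lemma parabolicV K w : parabolic M K w -> parabolic M K w^-1%g.
Proof.
move: w; apply: parabolic_ind => [|w k _ Kk Pw].
  by rewrite invg1; exact: parabolic1.
rewrite invgM; apply: parabolicM Pw.
have -> : (s k)^-1%g = s k by apply: mulg1_eq; exact: cox_genK.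
exact: parabolic_gen.
Qed.

Lemma act_parabolic_coord K w : parabolic M K w ->
  forall v i, ~~ K i -> act w v 0 i = v 0 i.
Proof.
move: w; apply: parabolic_ind => [|w k _ Kk IH] v i Ki; first by rewrite cox_act1.
rewrite cox_actM cox_act_gen IH // /refl !mxE eqxx.
have /negbTE -> : i != k by apply: contraNneq Ki => ->.
by rewrite mulr0 subr0.
Qed.

Lemma act_parabolic_supported K w v :
  parabolic M K w -> supported K v -> supported K (act w v).
Proof. by move=> Pw sv i Ki; rewrite (act_parabolic_coord Pw) // sv. Qed.

(** As u preserves the sign of vectors supported on K, a generator in K lengthens [u * w] exactly
    when it lengthens [w]. *)
Lemma cox_len_additive K u : (forall k, K k -> vpos (act u (sroot k))) ->
  forall w, parabolic M K w -> cox_len (u * w)%g = (cox_len u + cox_len w)%N.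
Proof.
move=> pu; apply: parabolic_ind => [|w k Pw Kk IH].
  by rewrite mulg1 cox_len1 addn0.
have sk := act_parabolic_supported Pw (supported_sroot Kk).
rewrite mulgA; have [pw|nw] := act_sroot_sign w k.
  rewrite !cox_len_mulgen_pos // ?IH ?addnS // cox_actM.
  exact: act_pos_comb pu pw sk.
have /cox_len_mulgen_neg : vpos (- act (u * w)%g (sroot k)).
  rewrite cox_actM -linearN; apply: act_pos_comb pu nw _ => i Ki.
  by rewrite mxE sk ?oppr0.
by rewrite IH (cox_len_mulgen_neg nw) addnS => -[->].
Qed.

(** Turns minimality in a coset into a sign condition on simple roots, the form in which it is used
    from here on. *)
Lemma min_repP K w :
  min_rep M K w <-> forall k, K k -> vpos (act w (sroot k)).
Proof.
split=> [mw k Kk | pw y Py]; last by rewrite (cox_len_additive pw) // leq_addr.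
have := mw _ (parabolic_gen Kk); have [//|/cox_len_mulgen_neg ->] := act_sroot_sign w k.
by rewrite ltnn.
Qed.

Lemma par_fact_ex K w :
  exists u y, [/\ min_rep M K u, parabolic M K y & w = (u * y)%g].
Proof.
move: {2}(cox_len w) (leqnn (cox_len w)) => b; elim: b w => [|b IH] w le_wb.
  exists 1%g, w; have -> : w = 1%g by apply: cox_len_eq0; lia.
  by split; rewrite ?mulg1 //; [move=> y _; rewrite cox_len1 | exact: parabolic1].
have [pw|/existsNP[k /not_implyP[Kk nk]]] :=
    pselect (forall k, K k -> vpos (act w (sroot k))).
  by exists w, 1%g; split; rewrite ?mulg1 //; [apply/min_repP | exact: parabolic1].
have [//|/cox_len_mulgen_neg lw] := act_sroot_sign w k.
have [|u [y [mu Py e]]] := IH (w * s k)%g; first by lia.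
exists u, (y * s k)%g; split=> //; last by rewrite mulgA -e (@cox_mulgenK _ M).
by apply: parabolicM => //; exact: parabolic_gen.
Qed.

Lemma par_fact_uniq K u y u' y' :
  min_rep M K u -> parabolic M K y -> min_rep M K u' -> parabolic M K y' ->
  (u * y = u' * y')%g -> u = u' /\ y = y'.
Proof.
move=> mu Py mu' Py' e.
have e1 : u' = (u * (y * y'^-1))%g by rewrite mulgA e mulgK.
have e2 : u = (u' * (y' * y^-1))%g by rewrite mulgA -e mulgK.
have P1 := parabolicM Py (parabolicV Py'); have P2 := parabolicM Py' (parabolicV Py).
(* Each of u and u' is the other one times an element of W_K, with lengths adding, so that element
   has length 0. *)
have l1 := cox_len_additive ((min_repP K u).1 mu) P1; have l2 := cox_len_additive ((min_repP K u').1 mu') P2.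
have /cox_len_eq0 yy : cox_len (y * y'^-1)%g = 0%N.
  by move: l1 l2; rewrite -e1 -e2; lia.
have {}yy : y = y' by apply: divg1_eq.
by split=> //; rewrite e1 yy mulgV mulg1.
Qed.

Lemma par_factE K u y : min_rep M K u -> parabolic M K y ->
  par_fact K (u * y)%g = (u, y).
Proof.
move=> mu Py; rewrite /par_fact; case: xgetP => [[u' y'] _ /= [mu' Py' e _]|].
  by have [-> ->] := par_fact_uniq mu Py mu' Py' e.
move=> /(_ (u, y)) []; split=> //=.
by rewrite (cox_len_additive ((min_repP K u).1 mu)).
Qed.

Lemma u_partE K u y : min_rep M K u -> parabolic M K y -> u_part K (u * y)%g = u.
Proof. by move=> mu Py; rewrite /u_part par_factE. Qed.

Lemma v_partE K u y : min_rep M K u -> parabolic M K y -> v_part K (u * y)%g = y.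
Proof. by move=> mu Py; rewrite /v_part par_factE. Qed.

Lemma par_partP K w :
  [/\ min_rep M K (u_part K w), parabolic M K (v_part K w),
      w = (u_part K w * v_part K w)%g
    & cox_len w = (cox_len (u_part K w) + cox_len (v_part K w))%N].
Proof.
have [u [y [mu Py ->]]] := par_fact_ex K w.
rewrite u_partE // v_partE //; split=> //.
exact: cox_len_additive ((min_repP K u).1 mu) _ Py.
Qed.

End Parabolic.

(** * Affine roots *)

Lemma sum_sym_even (N : nat) (S : 'I_N -> 'I_N -> int) :
  (forall i j, S i j = S j i) -> (forall i, (2 %| S i i)%Z) ->
  (2 %| \sum_i \sum_j S i j)%Z.
Proof.
move=> Ssym Sdiag.
have -> : \sum_i \sum_j S i j =
    \sum_i S i i + 2 * \sum_(i < N) \sum_(j : 'I_N | (j < i)%N) S i j.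
  have -> : \sum_i \sum_j S i j = \sum_i S i i +
      \sum_(i < N) (\sum_(j : 'I_N | (j < i)%N) S i j + \sum_(j : 'I_N | (i < j)%N) S i j).
    rewrite -big_split; apply: eq_bigr => i _ /=; rewrite (bigD1 i) //=; congr (_ + _).
    rewrite (bigID (fun j : 'I_N => (j < i)%N)) /=; congr (_ + _);
      apply: eq_bigl => j; rewrite -(inj_eq val_inj) /=; lia.
  congr (_ + _); rewrite big_split /= mulr_natl mulr2n; congr (_ + _).
  rewrite (exchange_big_dep xpredT) //=; apply: eq_bigr => i _.
  by apply: eq_bigr => j _.
by rewrite rpredD ?dvdz_mulr //; apply: rpred_sum => i _.
Qed.

Section Roots.
Variables (n : nat) (M : 'I_n.+1 -> 'I_n.+1 -> nat) (C : affine_datum M).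
Local Notation I := 'I_n.+1.
Local Notation V := 'rV[int]_n.+1.
Local Notation a := (cart C).
Local Notation d := (hsq C).
Local Notation r := (sqratio C).
Local Notation G := (coxgroup M).
Local Notation act := (@cox_act n M C).
Local Notation refl := (@refl n M C).
Local Notation copair := (@copair n M C).
Implicit Types (i j : I) (x y v : V) (u w : G).

Definition aform x y : int := \sum_i d i * x 0 i * copair i y.

Lemma hsq_gt0 i : 0 < d i.
Proof. by have [->|->] := hsqP C i; rewrite ?sqratio_gt0. Qed.

Lemma aformE x y : aform x y = \sum_i \sum_j d i * a i j * x 0 i * y 0 j.
Proof.
apply: eq_bigr => i _; rewrite mulr_sumr; apply: eq_bigr => j _; ring.
Qed.

Lemma aformC x y : aform x y = aform y x.
Proof.
rewrite !aformE exchange_big; apply: eq_bigr => i _; apply: eq_bigr => j _.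
rewrite (cart_sym C); ring.
Qed.

Lemma aformDr x y z : aform x (y + z) = aform x y + aform x z.
Proof. by rewrite -big_split; apply: eq_bigr => i _; rewrite copairD mulrDr. Qed.
Lemma aformZr c x y : aform x (c *: y) = c * aform x y.
Proof. rewrite mulr_sumr; apply: eq_bigr => i _; rewrite copairZ; ring. Qed.
Lemma aformDl x y z : aform (y + z) x = aform y x + aform z x.
Proof. by rewrite aformC aformDr !(aformC x). Qed.
Lemma aformZl c x y : aform (c *: y) x = c * aform y x.
Proof. by rewrite aformC aformZr aformC. Qed.
Lemma aformNr x y : aform x (- y) = - aform x y.
Proof. by rewrite -scaleN1r aformZr mulN1r. Qed.
Lemma aformNl x y : aform (- y) x = - aform y x.
Proof. by rewrite aformC aformNr aformC. Qed.
Lemma aform0r x : aform x 0 = 0.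
Proof. by rewrite -[0 in LHS](scale0r 0) aformZr mul0r. Qed.

Definition aformL := (aformDl, aformDr, aformNl, aformNr, aformZl, aformZr).

Lemma aform_sroot i x : aform (sroot i) x = d i * copair i x.
Proof.
rewrite /aform (bigD1 i) //= big1 => [|j ji].
  by rewrite srootE eqxx mulr1 addr0.
by rewrite srootE eq_sym (negbTE ji) mulr0 mul0r.
Qed.

Lemma aform_refl i x y : aform (refl i x) (refl i y) = aform x y.
Proof.
rewrite !reflE !aformL !aform_sroot !(aformC _ (sroot i)) !aform_sroot.
rewrite copair_sroot cart_diag; ring.
Qed.

Lemma aform_act w x y : aform (act w x) (act w y) = aform x y.
Proof.
rewrite /cox_act; move: (repr w) => s.
by elim: s x y => //= i s IH x y; rewrite aform_refl IH.
Qed.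

Definition delta : V := \row_i mark C i.

Lemma copair_delta i : copair i delta = 0.
Proof. by rewrite -(mark_null C i); apply: eq_bigr => j _; rewrite mxE. Qed.

Lemma aform_delta x : aform x delta = 0.
Proof. by apply: big1 => i _; rewrite copair_delta mulr0. Qed.
Lemma aform_deltal x : aform delta x = 0.
Proof. by rewrite aformC aform_delta. Qed.

Lemma refl_delta i : refl i delta = delta.
Proof. by rewrite !reflE copair_delta scale0r subr0. Qed.

Lemma act_delta w : act w delta = delta.
Proof. by rewrite /cox_act; elim: (repr w) => //= i s ->; exact: refl_delta. Qed.

Lemma vpos_delta : vpos delta.
Proof. by move=> i; rewrite mxE ltW ?mark_gt0. Qed.

Lemma cart_le0 i j : i != j -> a i j <= 0.
Proof.
move=> ij; have := cart_bond C ij; rewrite /bond_ok !inE.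
by do 6?[case/orP]; case/eqP => _ -> _.
Qed.

(* With x_i = m_i y_i, the form is - 1/2 sum_(i,j) c_ij (y_i - y_j)^2, where
   c_ij = d_i a_ij m_i m_j has null rows and columns. *)
Lemma aform_semidef x : 0 <= aform x x /\ (aform x x = 0 -> x = x 0 ord0 *: delta).
Proof.
pose m i : rat := (mark C i)%:~R.
have m0 i : 0 < m i by rewrite ltr0z mark_gt0.
pose y i : rat := (x 0 i)%:~R / m i.
have xy i : (x 0 i)%:~R = m i * y i by rewrite mulrC divfK // gt_eqF.
pose c i j : rat := (d i * a i j)%:~R * m i * m j.
have csym i j : c i j = c j i by rewrite /c (cart_sym C) mulrAC.
have crow i : \sum_j c i j = 0.
  rewrite (eq_bigr (fun j => (d i)%:~R * m i * (a i j * mark C j)%:~R)); last first.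
    by move=> j _; rewrite /c !intrM; ring.
  rewrite -mulr_sumr (_ : \sum_j _ = (\sum_j a i j * mark C j)%:~R).
    by rewrite mark_null mulr0.
  by rewrite rmorph_sum.
have fE : (aform x x)%:~R = \sum_i \sum_j c i j * y i * y j.
  rewrite aformE rmorph_sum; apply: eq_bigr => i _ /=.
  rewrite rmorph_sum; apply: eq_bigr => j _ /=.
  by rewrite !intrM /= !xy /c !intrM; ring.
have sq : \sum_i \sum_j - c i j * (y i - y j) ^+ 2 = 2 * (aform x x)%:~R.
  have e i j : - c i j * (y i - y j) ^+ 2 =
      2 * (c i j * y i * y j) + (- (y i ^+ 2) * c i j + - (y j ^+ 2) * c j i).
    by rewrite (csym j i); ring.
  rewrite (eq_bigr (fun i => \sum_j 2 * (c i j * y i * y j) +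
     (\sum_j - (y i ^+ 2) * c i j + \sum_j - (y j ^+ 2) * c j i))); last first.
    by move=> i _; rewrite -!big_split; apply: eq_bigr => j _; exact: e.
  rewrite !big_split /= [X in _ + (X + _)]big1; last first.
    by move=> i _; rewrite -mulr_sumr crow mulr0.
  rewrite exchange_big /= [X in _ + (_ + X)]exchange_big /=.
  rewrite [X in _ + (_ + X)]big1; last by move=> i _; rewrite -mulr_sumr crow mulr0.
  rewrite !addr0 fE mulr_sumr exchange_big /=.
  by apply: eq_bigr => i _; rewrite mulr_sumr.
have ge0 i j : 0 <= - c i j * (y i - y j) ^+ 2.
  have [->|ij] := eqVneq i j; first by rewrite subrr expr0n mulr0.
  apply: mulr_ge0; last exact: sqr_ge0.
  rewrite oppr_ge0 /c; do 2![apply: mulr_le0_ge0; last exact/ltW/m0].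
  by rewrite lerz0; apply: mulr_ge0_le0; rewrite ?cart_le0 // ltW ?hsq_gt0.
have F0 : (0 : rat) <= (aform x x)%:~R.
  have : 0 <= 2 * (aform x x)%:~R :> rat.
    by rewrite -sq; apply: sumr_ge0 => i _; apply: sumr_ge0 => j _; exact: ge0.
  by rewrite pmulr_rge0.
split=> [|f0]; first by move: F0; rewrite ler0z.
have yE i : y ord0 = y i.
  move: sq; rewrite f0 mulr0 => /psumr_eq0P sq.
  apply: (@cart_conn n M C (fun i => y ord0 = y i) _ ord0) => // {}i j aij ->.
  have := sq (fun i _ => sumr_ge0 _ (fun j _ => ge0 i j)) i isT.
  move/psumr_eq0P => /(_ (fun j _ => ge0 i j) j isT)/eqP.
  rewrite mulf_eq0 oppr_eq0 sqrf_eq0 subr_eq0 /c !mulf_eq0.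
  rewrite (gt_eqF (m0 i)) (gt_eqF (m0 j)) !orbF intr_eq0 mulf_eq0.
  by rewrite (negbTE aij) (gt_eqF (hsq_gt0 i)) /= => /eqP.
apply/rowP => i; rewrite !mxE; apply: (@intr_inj rat).
rewrite intrM !xy -yE /m mark0; ring.
Qed.

Lemma aform_ge0 x : 0 <= aform x x. Proof. by have [] := aform_semidef x. Qed.

Lemma aform_eq0 x : aform x x = 0 -> x = x 0 ord0 *: delta.
Proof. by have [] := aform_semidef x. Qed.

Lemma aform_fin_eq0 x : x 0 ord0 = 0 -> aform x x = 0 -> x = 0.
Proof. by move=> x0 /aform_eq0; rewrite x0 scale0r. Qed.

(* For e = sqratio this lattice contains the long roots, and singles them out
   among the vectors of their norm. *)
Definition inL (e : int) v : Prop := forall i, d i * v 0 i \in dvdz e.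

Lemma inL_form e x v : inL e v -> (e %| aform x v)%Z.
Proof.
by move=> ev; rewrite aformC; apply: rpred_sum => i _; rewrite dvdz_mulr ?ev.
Qed.

(** With k_i = d_i v_i / e the norm is e times the sum of the k_i a_ij v_j, which form a symmetric
    matrix with even diagonal. *)
Lemma inL_sq e v : 0 < e -> inL e v -> exists k, aform v v = 2 * e * k.
Proof.
move=> e0 ev; pose k i := divz (d i * v 0 i) e.
have kE i : d i * v 0 i = k i * e by rewrite divzK ?ev.
have : \sum_i \sum_j k i * (a i j * v 0 j) \in dvdz 2.
  apply: sum_sym_even => i => [j|].
    apply: (@mulfI _ e); first by rewrite gt_eqF.
    rewrite !mulrA ![e * _]mulrC -!kE.
    rewrite (_ : d i * _ * _ = (d i * a i j) * v 0 i); last ring.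
    by rewrite (cart_sym C); ring.
  by rewrite cart_diag mulrCA dvdz_mulr.
case/dvdzP => q Eq; exists q; rewrite /aform.
rewrite (eq_bigr (fun i => e * \sum_j k i * (a i j * v 0 j))); last first.
  by move=> i _; rewrite kE -mulr_sumr copairE; ring.
by rewrite -mulr_sumr Eq; ring.
Qed.

(** The real roots, cut out by norm and divisibility and not as an orbit: stability under
    reflections and under translation by [delta] becomes a computation. *)
Definition aroot v : Prop :=
  exists e, [/\ e = 1 \/ e = r, aform v v = 2 * e & inL e v].

Lemma inL1 v : inL 1 v. Proof. by move=> i; rewrite dvd1z. Qed.

Lemma inLD e x y : inL e x -> inL e y -> inL e (x + y).
Proof. by move=> ex ey i; rewrite mxE mulrDr rpredD. Qed.
Lemma inLZ e c x : inL e x -> inL e (c *: x).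
Proof. by move=> ex i; rewrite mxE mulrCA dvdz_mull. Qed.
Lemma inLN e x : inL e x -> inL e (- x).
Proof. by move=> ex; rewrite -scaleN1r; exact: inLZ. Qed.
Lemma inL_delta e : e = 1 \/ e = r -> inL e delta.
Proof. by case=> ->; [exact: inL1 | move=> i; rewrite mxE mark_dvd]. Qed.
Lemma inL_weaken e x : e = 1 \/ e = r -> inL r x -> inL e x.
Proof. by case=> -> // _; exact: inL1. Qed.

Lemma aroot_sroot i : aroot (sroot i).
Proof.
exists (d i); split; first exact: hsqP.
  by rewrite aform_sroot copair_sroot cart_diag mulrC.
move=> j; rewrite srootE; case: eqP => [->|_]; first by rewrite mulr1.
by rewrite mulr0 dvdz0.
Qed.

Lemma arootN v : aroot v -> aroot (- v).
Proof.
case=> e [e1 fv ev]; exists e; split=> //; last exact: inLN.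
by rewrite !aformL opprK.
Qed.

Lemma arootDdelta v c : aroot v -> aroot (v + c *: delta).
Proof.
case=> e [e1 fv ev]; exists e; split=> //.
  by rewrite !aformL !aform_delta aform_deltal fv; ring.
by apply: inLD => //; apply/inLZ/inL_delta.
Qed.

(* The reflection of x in y, with p the pairing of x with the coroot of y. *)
Lemma aroot_reflect x y p : aroot x -> inL r y \/ aroot y ->
  2 * aform x y = p * aform y y -> aroot (x - p *: y).
Proof.
move=> [e [e1 fx ex]] Ly fxy; exists e; split=> //.
  rewrite !aformL (aformC y x) fx.
  apply: (@mulfI _ 2) => //.
  transitivity (4 * e - 2 * p * (2 * aform x y) + 2 * p * (p * aform y y)); first ring.
  by rewrite fxy; ring.
apply: inLD => //; apply: inLN; case: Ly => [Ly|[e' [e1' fy ey]]].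
  by apply/inLZ/inL_weaken.
case: e1' => e1'; last first.
  by apply/inLZ/inL_weaken => //; rewrite -e1'.
(* For a short y the coefficient is a value of the form, which e divides because x lies in
   [inL e]. *)
have -> : p = aform x y.
  by apply: (@mulfI _ 2) => //; rewrite fxy fy e1'; ring.
by move=> i; rewrite mxE mulrCA mulrC dvdz_mull // aformC inL_form.
Qed.

Lemma aroot_refl i v : aroot v -> aroot (refl i v).
Proof.
move=> rv; apply: aroot_reflect => //; first by right; exact: aroot_sroot.
rewrite aformC !aform_sroot copair_sroot cart_diag; ring.
Qed.

Lemma aroot_act w v : aroot v -> aroot (act w v).
Proof. by move=> rv; rewrite /cox_act; elim: (repr w) => //= i s; exact: aroot_refl. Qed.

Lemma aroot_neq0 v : aroot v -> v <> 0.
Proof.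
case=> e [e1 fv _] v0; move: fv; rewrite v0 aform0r.
by case: e1 => ->; have := sqratio_gt0 C; lia.
Qed.

(* Both parts of a root lie in the lattice [inL e], whose nonzero norms are at
   least 2e, and they form an obtuse angle: one of them has norm 0, hence is
   a multiple of [delta]. *)
Lemma aroot_sign v : aroot v -> vpos v \/ vpos (- v).
Proof.
case=> e [e1 fv ev].
have e0 : 0 < e by case: e1 => ->; rewrite ?sqratio_gt0.
pose p : V := \row_i Num.max 0 (v 0 i); pose q : V := \row_i Num.max 0 (- v 0 i).
have vpq : v = p - q.
  by apply/rowP => i; rewrite !mxE; lia.
have ep : inL e p.
  by move=> i; rewrite mxE; case: (leP 0 (v 0 i)) => _; rewrite ?ev // mulr0 dvdz0.
have eq : inL e q.
  move=> i; rewrite mxE; case: (leP 0 (- v 0 i)) => _; last by rewrite mulr0 dvdz0.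
  by rewrite mulrN rpredN; exact: ev.
have pq : aform p q <= 0.
  rewrite aformE; apply: sumr_le0 => i _; apply: sumr_le0 => j _; rewrite !mxE.
  have [<-|ij] := eqVneq i j.
    by rewrite -mulrA (_ : _ * Num.max _ _ = 0) ?mulr0 //; lia.
  rewrite -mulrA; apply: mulr_le0_ge0; last by rewrite mulr_ge0 ?le_max ?lexx.
  by apply: mulr_ge0_le0; rewrite ?cart_le0 // ltW ?hsq_gt0.
have [k fp] := inL_sq e0 ep; have [l fq] := inL_sq e0 eq.
have : aform p p = 0 \/ aform q q = 0.
  have := aform_ge0 p; have := aform_ge0 q; move: fv.
  rewrite {1 2}vpq !aformL (aformC q p) fp fq => fv k0 l0.
  have : k + l <= 1 by nia.
  have k0' : 0 <= k by nia.
  have l0' : 0 <= l by nia.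
  by move=> kl; have [->|->] : k = 0 \/ l = 0 by [lia]; [left|right]; rewrite mulr0.
have half x : aform x x = 0 -> vpos x ->
    x = 0 \/ (forall i, 0 < x 0 i).
  move=> /aform_eq0 xE px; have [x0|x0] := eqVneq (x 0 ord0) 0.
    by left; rewrite xE x0 scale0r.
  right=> i; rewrite xE !mxE mulr_gt0 ?mark_gt0 //.
  by rewrite lt_neqAle eq_sym x0 px.
have pp : vpos p by move=> i; rewrite mxE le_max lexx.
have qp : vpos q by move=> i; rewrite mxE le_max lexx.
case=> [/half/(_ pp)|/half/(_ qp)] [h0|hpos].
- by right; rewrite vpq h0 sub0r opprK.
- by left=> i; have := hpos i; rewrite mxE lt_max ltxx => /ltW.
- by left; rewrite vpq h0 subr0.
- by right=> i; have := hpos i; rewrite !mxE lt_max ltxx => /ltW.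
Qed.

Lemma aroot_multiple_sroot c i : aroot (c *: sroot i) -> c = 1 \/ c = -1.
Proof.
case=> e [e1 + /(_ i)]; rewrite !aformL aform_sroot copair_sroot cart_diag.
rewrite mxE srootE eqxx mulr1 => fe /dvdzP[k dk].
have eE : e = c * c * d i by apply: (@mulfI _ 2) => //; rewrite -fe; ring.
have di := hsq_gt0 i; have [c0|c0] := eqVneq c 0.
  by move: e1 eE; rewrite c0 !mul0r; have := sqratio_gt0 C; lia.
have : c * k = 1.
  apply: (@mulfI _ (d i * c)); first by rewrite mulf_neq0 // gt_eqF.
  by rewrite mulr1 [RHS]dk eE; ring.
move/(congr1 absz); rewrite abszM => /eqP; rewrite muln_eq1 => /andP[/eqP c1 _]; lia.
Qed.

(** Only coordinate i changes, so a positive root that turns negative has no other coordinate. *)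
Lemma aroot_refl_pos i v : aroot v -> vpos v -> v <> sroot i -> vpos (refl i v).
Proof.
move=> rv pv vi; have [//|nv] := aroot_sign (aroot_refl i rv).
have vE : v = v 0 i *: sroot i.
  apply/rowP => j; rewrite mxE srootE; case: (eqVneq i j) => [<-|ij].
    by rewrite mulr1.
  have := nv j; rewrite !reflE !mxE eqxx eq_sym (negbTE ij) mulr0 subr0 oppr_ge0 => nj.
  by apply/eqP; rewrite mulr0 eq_le nj pv.
move: (rv); rewrite vE => /aroot_multiple_sroot[v1|v1].
  by case: vi; rewrite vE v1 scale1r.
by have := pv i; rewrite v1.
Qed.

(** A simple reflection permutes the positive roots other than its own, so each letter of a reduced
    word adds exactly one inversion. *)
Lemma inversions w : exists s : seq V,
  [/\ uniq s, size s = cox_len w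
    & forall v, v \in s <-> [/\ aroot v, vpos v & vpos (- act w v)]].
Proof.
move: {2}(cox_len w) (erefl (cox_len w)) => b; elim: b w => [|b IH] w lw.
  rewrite (cox_len_eq0 lw); exists [::]; split=> //; first by rewrite cox_len1.
  move=> v; split=> // -[rv pv]; rewrite cox_act1 => nv.
  by case: (aroot_neq0 rv); exact: vpos_anti.
have /cox_last[i wi] : w <> 1%g by move=> w1; rewrite w1 cox_len1 in lw.
pose w' := (w * cox_gen M i)%g; have ww : w = (w' * cox_gen M i)%g.
  by rewrite (@cox_mulgenK _ M).
have lw' : cox_len w' = b by move: wi; rewrite lw => -[].
have [s [us ss sP]] := IH w' lw'.
have pi : vpos (act w' (sroot i)).
  by apply: cox_len_pos; rewrite -ww lw lw'.
exists (sroot i :: [seq refl i v | v <- s]); split.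
- rewrite /= map_inj_uniq ?us ?andbT; last exact: (inv_inj (@reflK n M C i)).
  apply/mapP => -[v /sP[rv pv nv] e].
  have := @reflK n M C i v; rewrite -e => e'.
  have : vpos (- v); last by move/(vpos_anti pv); exact: aroot_neq0.
  rewrite -e' reflE copair_sroot cart_diag => j; rewrite !mxE.
  by case: (_ && _) => /=; lia.
- by rewrite /= size_map ss lw' lw.
move=> v; rewrite inE; split=> [/orP[/eqP->|/mapP[v' /sP[rv pv nv] ->]]|[rv pv nv]].
- split; [exact: aroot_sroot | exact: vpos_sroot |].
  by rewrite ww act_gen_sroot opprK.
- split; first exact: aroot_refl.
    apply: aroot_refl_pos => // e; rewrite e in nv.
    by case: (act_sroot_neq0 (C := C) (w := w') (i := i)); exact: vpos_anti.
  by rewrite ww cox_actM cox_act_gen reflK.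
have [//|vi /=] := eqVneq v (sroot i); apply/mapP.
exists (refl i v); last by rewrite reflK.
apply/sP; split; [exact: aroot_refl | by apply: aroot_refl_pos => //; apply/eqP |].
by rewrite -cox_act_gen -cox_actM -ww.
Qed.

(* Irreducibility: the simple roots not orthogonal to some root of
   {v | aform v x <> 0} form a component of the Dynkin diagram. *)
Lemma aroot_link x y i j : aform (sroot i) x <> 0 -> aform (sroot j) y <> 0 ->
  exists v, [/\ aroot v, aform v x <> 0 & aform v y <> 0].
Proof.
move=> xi yj; apply: contrapT => H.
have {}H v : aroot v -> aform v x <> 0 -> aform v y = 0.
  by move=> rv vx; apply: contrapT => vy; apply: H; exists v.
pose P k := exists v, [/\ aroot v, aform v x <> 0 & aform v (sroot k) <> 0].
have Py k : P k -> aform (sroot k) y = 0.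
  case=> v [rv vx vk]; have [kx|kx] := pselect (aform (sroot k) x = 0); last first.
    by apply: H => //; exact: aroot_sroot.
  have := H _ (aroot_refl k rv); rewrite !reflE aformDl aformNl aformZl kx mulr0 oppr0 addr0.
  rewrite aformDl aformNl aformZl H // sub0r => /(_ vx)/eqP.
  rewrite oppr_eq0 mulf_eq0 => /orP[/eqP v0|/eqP//].
  by case: vk; rewrite aformC aform_sroot v0 mulr0.
apply: yj; apply: Py; apply: (@cart_conn n M C P _ i).
  move=> k l akl [v [rv vx vk]].
  have kl : aform (sroot k) (sroot l) <> 0.
    by apply/eqP; rewrite aform_sroot copair_sroot mulf_neq0 // gt_eqF ?hsq_gt0.
  have [vl|vl] := pselect (aform v (sroot l) = 0); last by exists v.
  have [kx|kx] := pselect (aform (sroot k) x = 0); last first.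
    by exists (sroot k); split=> //; exact: aroot_sroot.
  exists (refl k v); split; first exact: aroot_refl.
    by rewrite !reflE aformDl aformNl aformZl kx mulr0 oppr0 addr0.
  rewrite !reflE aformDl aformNl aformZl vl sub0r; apply/eqP.
  rewrite oppr_eq0 mulf_neq0 //; last exact/eqP.
  by apply: contra_notN vk => /eqP v0; rewrite aformC aform_sroot v0 mulr0.
exists (sroot i); split=> //; first exact: aroot_sroot.
by apply/eqP; rewrite aform_sroot copair_sroot cart_diag mulf_neq0 // gt_eqF ?hsq_gt0.
Qed.

End Roots.

(** * Bad roots *)

Definition Sfin (n : nat) : pred 'I_n.+1 := fun i => (0 < i)%N.
Arguments Sfin {n}.

(* The two families of segments share one pattern. Either [kap = 1], [phi] is
   right multiplication by s_0, [top] is the highest root and [tau] the reflection s_0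
   (Type I), or [kap = 2], [phi] and [tau] are induced by the diagram
   automorphism, and [top] is twice the minuscule coweight fixed by J (Type II).
   In both cases [deg] is the pairing with the coroot of [top]. *)
Record grading (n : nat) (M : 'I_n.+1 -> 'I_n.+1 -> nat) (C : affine_datum M) :=
  Grading {
  kap : int;
  top : 'rV[int]_n.+1;
  deg : 'rV[int]_n.+1 -> int;
  tau : 'rV[int]_n.+1 -> 'rV[int]_n.+1;
  phi : coxgroup M -> coxgroup M;
  kapP : kap = 1 \/ kap = 2;
  top0 : top 0 ord0 = 0;
  topL : inL C (sqratio C) top;
  aform_top : forall v, aform C v top = sqratio C * kap * deg v;
  deg_top : deg top = 2;
  deg_sroot : forall k, Sfin k -> 0 <= deg (sroot k);
  tau_linear : linear tau;
  tauK : involutive tau;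
  tau_delta : tau (delta C) = delta C;
  tau_root : forall v, aroot C v -> aroot C (tau v);
  tau0 : forall v, tau v 0 ord0 = v 0 ord0 + deg v;
  deg_tau : forall v, deg (tau v) = - deg v;
  tau_J : forall k, Sfin k -> deg (sroot k) = 0 ->
    exists l, [/\ Sfin l, deg (sroot l) = 0 & tau (sroot k) = sroot l];
  phiK : involutive phi;
  phi_act : forall w v, vpos (cox_act C (phi w) v) <-> vpos (cox_act C w (tau v));
  tau1 : kap = 1 -> forall v, tau v = v + deg v *: (delta C - top);
  top1 : kap = 1 -> sroot ord0 = delta C - top;
  phi1 : kap = 1 -> forall w, phi w = (w * cox_gen M ord0)%g;
  phi2_len : kap = 2 -> forall w, cox_len (phi w) = cox_len w;
  tau2 : kap = 2 -> exists2 k, Sfin k & tau (sroot k) = sroot ord0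
}.

Section Core.
Variables (n : nat) (M : 'I_n.+1 -> 'I_n.+1 -> nat) (C : affine_datum M).
Variable D : grading C.
Local Notation I := 'I_n.+1.
Local Notation V := 'rV[int]_n.+1.
Local Notation r := (sqratio C).
Local Notation G := (coxgroup M).
Local Notation act := (@cox_act n M C).
Local Notation aform := (@aform n M C).
Local Notation aroot := (@aroot n M C).
Local Notation delta := (delta C).
Local Notation top := (top D).
Local Notation deg := (deg D).
Local Notation tau := (@tau n M C D).
Local Notation phi := (@phi n M C D).
Local Notation kap := (kap D).
Local Notation N := (r * kap).
Implicit Types (i j k : I) (x y v : V) (u w f : G).

HB.instance Definition _ :=
  GRing.isLinear.Build int V V *:%R tau (@tau_linear n M C D).

Definition finite v : Prop := v 0 ord0 = 0.
Definition finroot v : Prop := aroot v /\ finite v.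
Definition WS u : Prop := min_rep M Sfin u.
Definition WJ f : Prop := parabolic M Sfin f /\
  forall k, Sfin k -> deg (sroot k) = 0 -> vpos (act f (sroot k)).
(** The length that [phi] contributes to a segment: the letter s_0 in Type I, nothing for an
    automorphism. *)
Definition eps : nat := (kap == 1).

Lemma eps1 : kap = 1 -> eps = 1%N.
Proof. by rewrite /eps => ->. Qed.

Lemma N_gt0 : 0 < N.
Proof. by have := sqratio_gt0 C; have [->|->] := kapP D; lia. Qed.

Lemma degD x y : deg (x + y) = deg x + deg y.
Proof.
have N0 := N_gt0; apply: (@mulfI _ N); first by rewrite gt_eqF.
by rewrite mulrDr -!aform_top aformDl.
Qed.
Lemma degZ c x : deg (c *: x) = c * deg x.
Proof.
have N0 := N_gt0; apply: (@mulfI _ N); first by rewrite gt_eqF.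
by rewrite mulrCA -!aform_top aformZl.
Qed.
Lemma degN x : deg (- x) = - deg x.
Proof. by rewrite -scaleN1r degZ mulN1r. Qed.
Lemma deg_delta : deg delta = 0.
Proof.
have N0 := N_gt0; apply: (@mulfI _ N); first by rewrite gt_eqF.
by rewrite mulr0 -aform_top aform_deltal.
Qed.
Lemma degB x y : deg (x - y) = deg x - deg y. Proof. by rewrite degD degN. Qed.

Lemma finiteB x y : finite x -> finite y -> finite (x - y).
Proof. by rewrite /finite !mxE => -> ->. Qed.
Lemma finiteN x : finite x -> finite (- x).
Proof. by rewrite /finite !mxE => ->. Qed.
Lemma finrootN x : finroot x -> finroot (- x).
Proof. by case=> /arootN rx fx; split=> //; exact: finiteN. Qed.

Lemma finite_supported v : finite v -> supported Sfin v.
Proof.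
move=> fv i; rewrite /Sfin lt0n negbK => /eqP i0.
by rewrite (_ : i = ord0) //; apply: val_inj.
Qed.

Lemma coord0_act f v : parabolic M Sfin f -> act f v 0 ord0 = v 0 ord0.
Proof. by move=> Pf; rewrite (act_parabolic_coord C Pf). Qed.

Lemma finroot_act f v : parabolic M Sfin f -> finroot v -> finroot (act f v).
Proof.
move=> Pf [rv fv]; split; first exact: aroot_act.
by rewrite /finite coord0_act.
Qed.

Lemma deg_sum v : deg v = \sum_i v 0 i * deg (sroot i).
Proof.
have deg0 : deg 0 = 0 by rewrite -(scale0r 0) degZ mul0r.
rewrite {1}[v]sum_sroot (big_morph deg degD deg0).
by apply: eq_bigr => i _; rewrite degZ.
Qed.

Lemma deg_ge0 v : finite v -> vpos v -> 0 <= deg v.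
Proof.
move=> fv pv; rewrite deg_sum; apply: sumr_ge0 => i _.
case: (boolP (Sfin i)) => Si; last by rewrite (finite_supported fv Si) mul0r.
by rewrite mulr_ge0 ?deg_sroot.
Qed.

Lemma finroot_pos v : finroot v -> 0 < deg v -> vpos v.
Proof.
move=> [rv fv] dv; have [//|nv] := aroot_sign rv.
by have := deg_ge0 (finiteN fv) nv; rewrite degN; lia.
Qed.

Lemma aroot_coord0_pos v : aroot v -> 0 < v 0 ord0 -> vpos v.
Proof.
by move=> rv v0; have [//|/(_ ord0)] := aroot_sign rv; rewrite mxE oppr_ge0 leNgt v0.
Qed.

Lemma not_vpos_root v : aroot v -> ~ vpos v -> vpos (- v).
Proof. by move=> rv nv; have [] := aroot_sign rv. Qed.

Lemma vpos_root_neg v : aroot v -> vpos v -> vpos (- v) -> False.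
Proof. by move=> rv pv nv; apply: (aroot_neq0 rv); exact: vpos_anti. Qed.

Lemma aroot_sq_le v : aroot v -> aform v v <= 2 * r.
Proof.
case=> e [e1 -> _]; have := sqratio_gt0 C; case: e1 => ->; lia.
Qed.

Lemma top_root : kap = 1 -> aroot top.
Proof.
move=> k1; exists r; split; [by right| |exact: topL].
by rewrite aform_top k1 deg_top; ring.
Qed.

(** A root has norm at most 2r and [top] has norm 2 r kap, so the norm of [v - top] is nonnegative
    only if deg v <= 1 + 1/kap; degree 2 in Type I makes it zero. *)
Lemma deg_finroot_le2 v : finroot v -> deg v <= 2 /\ (deg v = 2 -> v = top /\ kap = 1).
Proof.
move=> [rv fv]; have := aform_ge0 C (v - top); have rp := sqratio_gt0 C.
have := aroot_sq_le rv.
have E : aform (v - top) (v - top) = aform v v - 2 * (N * deg v) + 2 * N.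
  by rewrite !aformL (aformC _ top v) !aform_top deg_top; ring.
rewrite E => le_v ge0; split.
  by have [e|e] := kapP D; rewrite e in ge0; nia.
move=> d2; rewrite d2 in ge0 E; have k1 : kap = 1.
  by have [//|e] := kapP D; rewrite e in ge0; nia.
split=> //; apply/eqP; rewrite -subr_eq0; apply/eqP; apply: (@aform_fin_eq0 _ _ C).
  by rewrite !mxE fv (top0 D).
by rewrite E; rewrite k1 in ge0 *; nia.
Qed.

Lemma WS_pos u v : WS u -> finite v -> vpos v -> vpos (act u v).
Proof.
by move=> /(min_repP C) mu fv pv; apply: act_pos_comb mu pv (finite_supported fv).
Qed.

Lemma WS_sign u v : WS u -> finroot v -> vpos (act u v) <-> vpos v.
Proof.
move=> mu [rv fv]; split=> [puv|]; last exact: WS_pos.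
have [//|nv] := aroot_sign rv; have := WS_pos mu (finiteN fv) nv.
by rewrite linearN => /(vpos_root_neg (aroot_act u rv) puv).
Qed.

Lemma phi_act_neg w v : vpos (- act (phi w) v) <-> vpos (- act w (tau v)).
Proof. by rewrite -!linearN; exact: phi_act. Qed.

(* I.e. no [act f v] is a bad root of u. *)
Definition good u f : Prop :=
  forall v, finroot v -> 0 < deg v -> vpos (act u (delta - act f v)).

(** [tau] raises the coordinate at s_0 by the degree, so v |-> delta - tau v is an involution of the
    finite roots of degree 1. It exchanges inversions of f and bad roots of [phi f] in that
    degree. *)
Lemma tau_deg1 v : finroot v -> deg v = 1 ->
  [/\ finroot (delta - tau v), deg (delta - tau v) = 1 & tau (delta - v) = delta - tau v].
Proof.
move=> [rv fv] dv; split.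
- split; last by rewrite /finite !mxE tau0 fv dv mark0.
  rewrite addrC -[delta]scale1r; apply: arootDdelta; apply: arootN; exact: tau_root.
- by rewrite degB deg_delta deg_tau dv.
- by rewrite linearB /= tau_delta.
Qed.

Lemma finroot_delta v : finroot v -> aroot (delta - v).
Proof.
by case=> rv _; rewrite addrC -[delta]scale1r; apply: arootDdelta; apply: arootN.
Qed.

Lemma deg_finroot_cases v : finroot v -> 0 < deg v -> deg v = 1 \/ v = top /\ kap = 1.
Proof.
move=> rv dv; have [d2 dt] := deg_finroot_le2 rv.
have [/dt|d1] : deg v = 2 \/ deg v = 1 by [lia]; [by right | by left].
Qed.

Lemma cox_len_eps w : (kap = 1 -> vpos (act w (delta - top))) <->
  cox_len (phi w) = (cox_len w + eps)%N.
Proof.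
rewrite /eps; have [k1|k2] := kapP D; last first.
  by rewrite k2 (phi2_len k2) addn0; split=> // _.
rewrite k1 (phi1 k1) -(top1 k1) addn1; split=> [/(_ erefl)|lw _].
  exact: cox_len_mulgen_pos.
by apply: cox_len_pos; rewrite lw.
Qed.

(** [WS] is tested on simple roots. Those of degree 0 go under [tau] to simple roots of degree 0, on
    which u f is positive; one of degree 1 goes to delta - v with v of degree 1, where goodness
    applies. The length condition accounts for [top] in Type I. *)
Lemma goodP u f : WS u -> WJ f ->
  (WS (phi (u * f)%g) /\
   cox_len (phi (u * f)%g) = (cox_len u + cox_len f + eps)%N) <-> good u f.
Proof.
move=> mu [Pf Jf].
rewrite -(cox_len_additive ((min_repP C _ _).1 mu) Pf) -cox_len_eps cox_actM.
have actE v : act u (act f (delta - v)) = act u (delta - act f v).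
  by rewrite linearB /= act_delta.
split=> [[mp lp] v rv dv|gd].
  have [d1|[-> /lp]] := deg_finroot_cases rv dv; last by rewrite actE.
  have [rt dt te] := tau_deg1 rv d1.
  rewrite -actE -cox_actM -[delta - v](tauK D) -phi_act te.
  by apply/(WS_sign mp rt)/finroot_pos => //; rewrite dt.
split=> [|k1]; last first.
  by rewrite actE; apply: gd; [split; [exact: top_root | exact: top0] | rewrite deg_top].
apply/(min_repP C) => k Sk; rewrite phi_act cox_actM.
have fk : finroot (sroot k).
  by split; [exact: aroot_sroot | rewrite /finite srootE; case: eqP Sk => // ->].
have [d0|dk] : deg (sroot k) = 0 \/ 0 < deg (sroot k).
  by have := deg_sroot D Sk; lia.
  have [l [Sl dl ->]] := tau_J Sk d0; apply: WS_pos => //; last exact: Jf.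
  rewrite /finite coord0_act // srootE.
  by case: eqP Sl => // ->.
have [d1|[kt k1]] := deg_finroot_cases fk dk.
  have [rt dt te] := tau_deg1 fk d1.
  rewrite -[tau (sroot k)](subKr delta) actE; apply: gd => //.
  by rewrite dt.
(* A simple root equal to [top] occurs only in affine A_1; its image under [tau] is 2 delta -
   top. *)
rewrite kt (tau1 k1) deg_top (_ : top + _ = delta + (delta - top)); last first.
  by apply/rowP => i; rewrite !mxE; ring.
rewrite linearD linearD /= !act_delta; apply: vposD; first exact: vpos_delta.
by rewrite actE; apply: gd; [split; [exact: top_root | exact: top0] | rewrite deg_top].
Qed.

Lemma WS1 : WS 1%g.
Proof. by apply/(min_repP C) => k _; rewrite cox_act1; exact: vpos_sroot. Qed.

Lemma good1 f : WJ f -> good 1%g f.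
Proof.
move=> [Pf _] v rv _; rewrite cox_act1.
have fv := finroot_act Pf rv; apply: aroot_coord0_pos; first exact: finroot_delta.
by rewrite !mxE fv.2 mark0.
Qed.

Lemma WS_phi f : WJ f -> WS (phi f).
Proof. by move=> Jf; have [+ _] := (goodP WS1 Jf).2 (good1 Jf); rewrite mul1g. Qed.

(** After [tau] and [f] the root is still finite, so u does not affect its sign: in degree 1 the bad
    roots depend on the last factor alone. *)
Lemma phi_deg1 u f v : WS u -> parabolic M Sfin f -> finroot v -> deg v = 1 ->
  vpos (act (phi (u * f)%g) (delta - v)) <-> vpos (act f (delta - tau v)).
Proof.
move=> mu Pf rv dv; have [rt dt te] := tau_deg1 rv dv.
by rewrite phi_act cox_actM te WS_sign //; exact: finroot_act.
Qed.

(** [tau] negates [delta - top], the simple root of the letter s_0 just appended. *)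
Lemma phi_top u f : kap = 1 -> WS u -> WJ f -> good u f ->
  ~ vpos (act (phi (u * f)%g) (delta - top)).
Proof.
move=> k1 mu Jf gd; rewrite phi_act (tau1 k1) degB deg_delta deg_top.
rewrite (_ : _ + _ = - (delta - top)); last first.
  by apply/rowP => i; rewrite !mxE; ring.
rewrite linearN; apply: (vpos_root_neg (v := act (u * f)%g (delta - top))).
  by rewrite -(top1 k1); apply/aroot_act/aroot_sroot.
rewrite cox_actM linearB /= act_delta; apply: gd; last by rewrite deg_top.
by split; [exact: top_root | exact: top0].
Qed.

(** * The position of the image of [top] under a finite element relative to [top] *)

Section Relative.
Variable f : G.
Hypothesis Pf : parabolic M Sfin f.
Local Notation beta := (act f top).
Local Notation dg v := (deg (act f^-1%g v)).

Lemma aform_beta v : aform v beta = N * dg v.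
Proof. by rewrite -(aform_act C f^-1%g) cox_actK aform_top. Qed.

Lemma dgD x y : dg (x + y) = dg x + dg y. Proof. by rewrite linearD degD. Qed.
Lemma dgN x : dg (- x) = - dg x. Proof. by rewrite linearN degN. Qed.
Lemma dgB x y : dg (x - y) = dg x - dg y. Proof. by rewrite dgD dgN. Qed.

Lemma dg_beta : dg beta = 2. Proof. by rewrite cox_actK deg_top. Qed.

Lemma dg_top : dg top = deg beta.
Proof.
apply: (@mulfI _ N); first by rewrite gt_eqF ?N_gt0.
by rewrite -aform_beta aformC aform_top.
Qed.

Lemma beta_finite : finite beta.
Proof. by rewrite /finite coord0_act ?top0. Qed.

Lemma betaL : inL C r beta.
Proof.
rewrite /cox_act; have := topL D; move: top; elim: (repr f) => //= i s IH x Lx.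
have L := IH _ Lx; apply: inLD => //; apply: inLN => j; rewrite mxE srootE.
case: eqP => [<-|_]; last by rewrite !mulr0 dvdz0.
by rewrite mulr1 -aform_sroot; exact: inL_form.
Qed.

Lemma beta_root : kap = 1 -> aroot beta.
Proof. by move=> k1; apply/aroot_act/top_root. Qed.

Lemma dg_finroot_le2 v : finroot v -> dg v <= 2 /\ (dg v = 2 -> v = beta /\ kap = 1).
Proof.
move=> rv; have [le2 eq2] := deg_finroot_le2 (finroot_act (parabolicV Pf) rv).
by split=> // /eq2[<- ?]; rewrite cox_actVK.
Qed.

(* Simple reflections move [beta] by even multiples of simple roots if kap = 2. *)
Lemma deg_beta_even : kap = 2 -> exists c, deg beta = 2 * c.
Proof.
move=> k2.
suff [y ->] : exists y, beta = top + 2 *: y.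
  by exists (1 + deg y); rewrite degD degZ deg_top; ring.
rewrite -[f]cox_wordK; elim: (repr f) => [|i s [y IH]].
  by exists 0; rewrite scaler0 addr0 cox_act_word.
rewrite cox_act_word /= -cox_act_word; set w := cox_word M s in IH *.
have : hsq C i * copair C i (act w top) = 2 * r * deg (act w^-1%g (sroot i)).
  rewrite -aform_sroot -(aform_act C w^-1%g) cox_actK aform_top k2; ring.
move: (deg _) => c cE; have rp := sqratio_gt0 C.
have [l lE] : exists l, copair C i (act w top) = 2 * l.
  have [e|e] := hsqP C i; rewrite e in cE; first by exists (r * c); lia.
  by exists c; nia.
by exists (y - l *: sroot i); rewrite /refl lE IH; apply/rowP => j; rewrite !mxE; ring.
Qed.

Lemma aform_beta2 : aform beta beta = 2 * N.
Proof. by rewrite aform_beta dg_beta mulrC. Qed.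

(** [beta] has the norm of [top], so the norms of beta + top and beta - top bound the degree by 2 in
    absolute value, one of them vanishing at each bound. In Type II the degree is even. *)
Lemma deg_beta_cases :
  [\/ deg beta = 2 /\ beta = top, deg beta = -2 /\ beta = - top, deg beta = 0
    | (deg beta = 1 \/ deg beta = -1) /\ kap = 1].
Proof.
have Np := N_gt0; have [ft fb] := (top0 D, beta_finite).
have E e : e * e = 1 -> aform (beta + e *: top) (beta + e *: top) =
    N * (4 + 2 * (e * deg beta)).
  move=> e1; rewrite !aformL (aformC _ top beta) !aform_top aform_beta2 deg_top.
  by rewrite (_ : e * (e * (N * 2)) = 2 * N); [ring | rewrite mulrA e1; ring].
have eq0 e : e * e = 1 -> e * deg beta = -2 -> beta = - (e *: top).
  move=> e1 ed; apply/eqP; rewrite -subr_eq0 opprK; apply/eqP.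
  apply: (@aform_fin_eq0 _ _ C); first by rewrite !mxE ft mulr0 addr0.
  by rewrite E // ed; ring.
have := aform_ge0 C (beta + 1 *: top); have := aform_ge0 C (beta + (-1) *: top).
rewrite !E // !pmulr_rge0 // => le2 ge2.
have [c|c] := eqVneq (deg beta) 2.
  by constructor 1; split=> //; rewrite (eq0 (-1)) ?c // scaleN1r opprK.
have [c'|c'] := eqVneq (deg beta) (-2).
  by constructor 2; split=> //; rewrite (eq0 1) ?c' // scale1r.
have [c0|c0] := eqVneq (deg beta) 0; [by constructor 3 | constructor 4].
split; first by lia.
have [//|k2] := kapP D; have [l lE] := deg_beta_even k2; lia.
Qed.

Lemma finroot_reflect x y p : finroot x -> finite y -> inL C r y \/ aroot y ->
  2 * aform x y = p * aform y y -> finroot (x - p *: y).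
Proof.
move=> [rx fx] fy Ly e; split; first exact: aroot_reflect.
by rewrite /finite !mxE fx fy mulr0 subrr.
Qed.

Lemma finroot_sub x y : finroot x -> finite y -> inL C r y \/ aroot y ->
  2 * aform x y = aform y y -> finroot (x - y).
Proof.
by move=> rx fy Ly e; rewrite -[y in _ - y]scale1r; apply: finroot_reflect; rewrite ?mul1r.
Qed.

(** This is the reflection of x in [top]. It preserves roots even in Type II, where [top] is not a
    root, because [top] lies in [inL r]. *)
Lemma finroot_sub_top x : finroot x -> deg x = 1 -> finroot (x - top).
Proof.
move=> rx dx; apply: finroot_sub => //; [exact: top0 | left; exact: topL |].
by rewrite !aform_top deg_top dx mulr1 mulrC.
Qed.

Lemma finroot_sub_beta x : finroot x -> dg x = 1 -> finroot (x - beta).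
Proof.
move=> rx dx; apply: finroot_sub => //; [exact: beta_finite | left; exact: betaL |].
by rewrite !aform_beta dg_beta dx mulr1 mulrC.
Qed.

(** Irreducibility gives a root pairing with both [top] and [beta]. Degree 2 on one side would make
    it [top] or [beta], orthogonal to the other, so up to sign both degrees are 1; if the signs
    differ, reflecting in [top] repairs one of them. *)
Lemma deg_beta0_link : deg beta = 0 -> exists x, [/\ finroot x, deg x = 1 & dg x = 1].
Proof.
move=> c0; have Np := N_gt0; have c0' : dg top = 0 by rewrite dg_top.
have ex z : aform z z <> 0 -> exists i, aform (sroot i) z <> 0.
  move=> z0; apply: contrapT => H; apply: z0.
  rewrite {1}[z]sum_sroot (big_morph (aform^~ z) (aformDl C z) (id1 := 0)); last first.
    by rewrite aformC aform0r.
  apply: big1 => i _; rewrite aformZl; apply/eqP; rewrite mulf_eq0 orbC.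
  by apply/orP; left; apply/eqP; apply: contrapT => h; apply: H; exists i.
have [i ti] : exists i, aform (sroot i) top <> 0.
  by apply: ex; rewrite aform_top deg_top; lia.
have [j bj] : exists j, aform (sroot j) beta <> 0.
  by apply: ex; rewrite aform_beta2; lia.
have [v [rv vt vb]] := aroot_link ti bj.
pose x := v - v 0 ord0 *: delta.
have rx : finroot x.
  split; first by rewrite /x -scaleNr; exact: arootDdelta.
  by rewrite /finite !mxE mark0 mulr1 subrr.
have dx : deg x <> 0.
  by move=> dx; apply: vt; rewrite aform_top -(subrK (v 0 ord0 *: delta) v) degD dx degZ deg_delta; ring.
have gx : dg x <> 0.
  move=> gx; apply: vb; rewrite aform_beta -(subrK (v 0 ord0 *: delta) v) dgD gx.
  by rewrite linearZ /= act_delta degZ deg_delta; ring.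
have le1 y : finroot y -> deg y <> 0 -> dg y <> 0 -> deg y <= 1 /\ dg y <= 1.
  move=> ry dy gy; have [d2 d2E] := deg_finroot_le2 ry; have [g2 g2E] := dg_finroot_le2 ry.
  split.
    by have [/d2E[e _]|] : deg y = 2 \/ deg y <= 1 by [lia]; [case: gy; rewrite e|].
  by have [/g2E[e _]|] : dg y = 2 \/ dg y <= 1 by [lia]; [case: dy; rewrite e|].
have [d1 g1] := le1 x rx dx gx.
have [] := le1 (- x) (finrootN rx); rewrite ?degN ?dgN; [lia | lia |] => d1' g1'.
have fix_ y : finroot y -> deg y = 1 -> dg y = -1 ->
    exists x, [/\ finroot x, deg x = 1 & dg x = 1].
  move=> ry dy gy; exists (- (y - top)); split.
  - by apply/finrootN/finroot_sub_top.
  - by rewrite degN degB deg_top dy.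
  - by rewrite dgN dgB c0' gy.
have [[e1 e2]|[[e1 e2]|[[e1 e2]|[e1 e2]]]] : (deg x = 1 /\ dg x = 1) \/ (deg x = 1 /\ dg x = -1) \/
    (deg x = -1 /\ dg x = 1) \/ (deg x = -1 /\ dg x = -1) by lia.
- by exists x.
- exact: fix_ rx e1 e2.
- by apply: (fix_ (- x)); [exact: finrootN | rewrite degN e1 | rewrite dgN e2].
- by exists (- x); split; [exact: finrootN | rewrite degN e1 | rewrite dgN e2].
Qed.

(* Either x1 = x2 is half of top + beta, or x1 and x2 are orthogonal long roots. *)
Lemma deg_beta0_pair : deg beta = 0 -> exists x1 x2,
  [/\ [/\ finroot x1, deg x1 = 1 & dg x1 = 1], [/\ finroot x2, deg x2 = 1 & dg x2 = 1],
      x1 + x2 = top + beta,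
      forall v, finroot v -> deg v + dg v = 1 ->
        2 * aform v x1 = aform x1 x1 \/ 2 * aform v x2 = aform x2 x2
    & forall v y, deg v + dg v = 1 -> deg y + dg y = 1 ->
        2 * aform v x1 = aform x1 x1 -> 2 * aform y x2 = aform x2 x2 ->
        v - x1 = y - x2 -> 2 * aform y x1 = aform x1 x1].
Proof.
move=> c0; have Np := N_gt0; have rp := sqratio_gt0 C.
have [x1 [r1 d1 g1]] := deg_beta0_link c0.
pose x2 := top + beta - x1; exists x1, x2.
have d2 : deg x2 = 1 by rewrite /x2 degB degD deg_top c0 d1.
have g2 : dg x2 = 1 by rewrite /x2 dgB dgD dg_beta dg_top c0 g1.
have r2 : finroot x2.
  have -> : x2 = - ((x1 - top) - beta) by apply/rowP => i; rewrite !mxE; ring.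
  apply/finrootN/finroot_sub_beta; first exact: finroot_sub_top.
  by rewrite dgB dg_top c0 g1.
have sumE v : aform v x1 + aform v x2 = N * (deg v + dg v).
  by rewrite /x2 !aformL aform_top aform_beta; ring.
have q12 : aform x2 x2 = aform x1 x1.
  rewrite /x2 !aformL !(aformC _ _ x1) (aformC _ beta top) !aform_top !aform_beta.
  by rewrite deg_top dg_beta d1 g1 dg_top c0; ring.
(* The norm of x1 - x2 is 4 (aform x1 x1 - N), which vanishes unless x1 is long in Type I. *)
have dich : x1 = x2 /\ aform x1 x1 = N \/
    [/\ kap = 1, inL C r x1, inL C r x2 & aform x1 x1 = 2 * r].
  have fE : aform (x1 - x2) (x1 - x2) = 4 * (aform x1 x1 - N).
    have -> : x1 - x2 = 2 *: x1 - (top + beta) by apply/rowP => i; rewrite !mxE; ring.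
    rewrite !aformL !(aformC _ _ x1) (aformC _ beta top) !aform_top !aform_beta.
    by rewrite deg_top dg_beta d1 g1 dg_top c0; ring.
  have eqx : aform x1 x1 = N -> x1 = x2 /\ aform x1 x1 = N.
    move=> e; split=> //; apply/eqP; rewrite -subr_eq0; apply/eqP.
    apply: (@aform_fin_eq0 _ _ C); first exact: finiteB r1.2 r2.2.
    by rewrite fE e subrr mulr0.
  have := aform_ge0 C (x1 - x2); rewrite fE => ge0.
  case: (r1.1) => e [e1 fx Lx]; have [k1|k2] := kapP D.
    have [er|er] := pselect (e = r).
      right; rewrite er in Lx fx; split=> //.
      apply: inLD; last exact: inLN.
      by apply: inLD; [exact: topL | exact: betaL].
    by left; apply: eqx; move: er ge0; rewrite k1 fx; case: e1 => ->; lia.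
  left; apply: eqx; move: ge0; rewrite k2 fx; case: e1 => ->; lia.
split=> //; first by rewrite /x2 addrC subrK.
  move=> v rv dv; have := sumE v; rewrite dv mulr1.
  case: dich => [[<- ->]|[k1 L1 L2 q1]] s; first by left; lia.
  rewrite q12 q1; move: s; rewrite k1 mulr1.
  have [p pE] := dvdzP (inL_form v L1); have [p' pE'] := dvdzP (inL_form v L2).
  (* A pairing of 2 with the coroot of x would give v = x, against [deg v + dg v = 1]. *)
  have bound x q : finroot x -> aform x x = 2 * r -> deg x = 1 -> dg x = 1 ->
      aform v x = q * r -> q <= 1.
    move=> rx qx dx gx vx; have := aform_ge0 C (v - x); have := aroot_sq_le rv.1.
    have E : aform (v - x) (v - x) = aform v v + 2 * r - 2 * (q * r).
      by rewrite !aformL (aformC _ x v) vx qx; ring.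
    rewrite E => lev ge0; have [q2|] : q = 2 \/ q <= 1 by [nia]; last by [].
    have : v = x; last by move=> e; move: dv; rewrite e dx gx.
    apply/eqP; rewrite -subr_eq0; apply/eqP.
    apply: (@aform_fin_eq0 _ _ C); first exact: finiteB rv.2 rx.2.
    by rewrite E q2; rewrite q2 in ge0; lia.
  have := bound _ _ r1 q1 d1 g1 pE; have := bound _ _ r2 (etrans q12 q1) d2 g2 pE'.
  rewrite pE pE' => l1 l2 s.
  have pp : p + p' = 1 by nia.
  by have [->|->] : p = 1 \/ p' = 1 by [lia]; [left|right]; ring.
move=> v w dv dw e1 e2 vw; case: dich => [[xx _]|[k1 L1 L2 q1]].
  by rewrite xx.
(* Pairing with x1 gives -r on the left and 0 on the right. *)
exfalso; have : aform (v - x1) x1 = aform (w - x2) x1 by rewrite vw.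
have := sumE w; have := sumE x1; rewrite dw d1 g1 k1 !aformDl !aformNl (aformC _ x2 x1).
move: e1 e2; rewrite q12 q1; lia.
Qed.

End Relative.
End Core.

(** * Locality of goodness and comparison of the lengths of consecutive segments *)

Section Steps.
Variables (n : nat) (M : 'I_n.+1 -> 'I_n.+1 -> nat) (C : affine_datum M).
Variable D : grading C.
Local Notation I := 'I_n.+1.
Local Notation V := 'rV[int]_n.+1.
Local Notation r := (sqratio C).
Local Notation G := (coxgroup M).
Local Notation act := (@cox_act n M C).
Local Notation aform := (@aform n M C).
Local Notation aroot := (@aroot n M C).
Local Notation finroot := (@finroot n M C).
Local Notation delta := (delta C).
Local Notation top := (top D).
Local Notation deg := (deg D).
Local Notation tau := (@tau n M C D).
Local Notation phi := (@phi n M C D).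
Local Notation kap := (kap D).
Local Notation N := (r * kap).
Local Notation WS := (@WS n M).
Local Notation WJ := (WJ D).
Local Notation good := (good D).
Implicit Types (i j k : I) (x y v : V) (u w f : G).

Lemma top_finroot : kap = 1 -> finroot top.
Proof. by move=> k1; split; [exact: top_root | exact: top0]. Qed.

(** The witness follows the position of [act f top]: x1 or x2 of [deg_beta0_pair] if it is
    orthogonal to [top], itself in degree 1, its sum with [top] in degree -1. In each case x - y is
    a root of degree -1, hence negative. *)
Lemma finroot_above f x : parabolic M Sfin f -> finroot x -> deg x = 0 ->
  0 < deg (act f^-1%g x) ->
  exists y, [/\ finroot y, deg y = 1, 0 < deg (act f^-1%g y) & vpos (y - x)].
Proof.
move=> Pf rx dx gx; have Np := N_gt0 D.
have pos y : finroot (x - y) -> deg y = 1 -> vpos (y - x).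
  move=> rxy dy; rewrite -opprB; apply: (@finroot_pos _ _ _ D); first exact: finrootN.
  by rewrite degN degB dy dx.
have [_ g2] := dg_finroot_le2 D Pf rx.
have gx1 : deg (act f top) <> 0 -> deg (act f^-1%g x) = 1.
  move=> c0; have [g2'|] : deg (act f^-1%g x) = 2 \/ deg (act f^-1%g x) = 1.
    by have [] := dg_finroot_le2 D Pf rx; lia.
    by have [e _] := g2 g2'; rewrite -e dx in c0.
  by [].
have b0 := beta_finite D Pf.
have orth e : act f top = e *: top -> False.
  move=> bE; have := aform_beta D f x; rewrite bE aformZr aform_top dx !mulr0.
  by move=> e0; move: gx; nia.
case: (deg_beta_cases D Pf) => [[_ bE]|[_ bE]|c0|[c1 k1]].
- by case: (orth 1); rewrite scale1r.
- by case: (orth (-1)); rewrite scaleN1r.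
- have [x1 [x2 [[r1 d1 g1] [r2 d2 g2'] _ pick _]]] := deg_beta0_pair Pf c0.
  have [gx2|gx1'] : deg (act f^-1%g x) = 2 \/ deg (act f^-1%g x) = 1.
    by have [] := dg_finroot_le2 D Pf rx; lia.
    have [xb _] := g2 gx2; exists x1; split=> //; first by rewrite g1.
    by apply: pos => //; rewrite -opprB xb; apply/finrootN/finroot_sub_beta.
  have [|e|e] := pick x rx; first by rewrite dx gx1'.
    exists x1; split=> //; first by rewrite g1.
    by apply: pos => //; apply: finroot_sub => //; [exact: r1.2 | right; exact: r1.1].
  exists x2; split=> //; first by rewrite g2'.
  by apply: pos => //; apply: finroot_sub => //; [exact: r2.2 | right; exact: r2.1].
have {}gx1 : deg (act f^-1%g x) = 1 by apply: gx1; lia.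
case: c1 => c1.
  exists (act f top); split=> //.
  - by split; [exact: beta_root | ].
  - by rewrite dg_beta.
  - by apply: pos => //; exact: finroot_sub_beta.
have rb : finroot (act f top + top).
  rewrite -[X in _ + X]opprK -[- top]scaleN1r; apply: finroot_reflect => //.
  - by split; [exact: beta_root | ].
  - exact: top0.
  - by left; exact: topL.
  by rewrite !aform_top deg_top c1; ring.
exists (act f top + top); split=> //.
- by rewrite degD deg_top c1.
- by rewrite dgD dg_beta dg_top c1.
apply: pos; last by rewrite degD deg_top c1.
apply: finroot_sub => //; [exact: rb.2 | right; exact: rb.1 |].
rewrite !aformL (aformC _ top (act f top)) !aform_top !aform_beta.
by rewrite gx1 dx deg_top dg_beta c1; ring.
Qed.

(** After [tau] the coordinate at s_0 is 1 - deg v, which is positive and is left alone by f in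
    W_S. *)
Lemma phi_finroot_pos f v : WJ f -> finroot v -> deg v <= 0 ->
  vpos (act (phi f) (delta - v)).
Proof.
move=> [Pf Jf] rv dv; rewrite phi_act linearB /= tau_delta.
apply: aroot_coord0_pos.
  apply: aroot_act; rewrite addrC -[delta]scale1r; apply: arootDdelta.
  by apply/arootN/tau_root/rv.1.
by rewrite coord0_act // !mxE tau0 rv.2 mark0; lia.
Qed.

(** The harder direction is from right to left: [phi (u' * f2)] may have bad roots of degree 0,
    while [phi f2] has none. *)
Lemma good_local u' f2 f1 : WS u' -> WJ f2 -> WJ f1 -> good u' f2 ->
  good (phi (u' * f2)%g) f1 <-> good (phi f2) f1.
Proof.
move=> mu' Jf2 Jf1 gd2; have Pf1 := Jf1.1; have Pf2 := Jf2.1.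
have [mu _] := (goodP mu' Jf2).2 gd2.
have local v : finroot v -> deg v = 1 ->
    vpos (act (phi (u' * f2)%g) (delta - v)) <-> vpos (act (phi f2) (delta - v)).
  move=> rv dv; rewrite phi_deg1 //.
  by have := phi_deg1 (WS1 C) Pf2 rv dv; rewrite mul1g => ->.
(* [top] is always bad here, so a root of positive degree that passes the test has degree 1. *)
have nottop u : WS u -> good u f2 -> forall v, finroot v -> 0 < deg v ->
    vpos (act (phi (u * f2)%g) (delta - v)) -> deg v = 1.
  move=> mw gw v rv dv; have [//|[-> k1]] := deg_finroot_cases rv dv.
  by move/(phi_top k1 mw Jf2 gw).
have nottop2 v : finroot v -> 0 < deg v -> vpos (act (phi f2) (delta - v)) -> deg v = 1.
  by have := nottop _ (WS1 C) (good1 Jf2) v; rewrite mul1g.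
split=> gd v rv dv; have rfv := finroot_act Pf1 rv.
  have [d0|d0] : deg (act f1 v) <= 0 \/ 0 < deg (act f1 v) by lia.
    exact: phi_finroot_pos.
  have pv := gd v rv dv; have d1 := nottop _ mu' gd2 _ rfv d0 pv.
  by apply/local.
have pv := gd v rv dv.
have rd := aroot_act (phi (u' * f2)%g) (finroot_delta rfv).
apply: contrapT => /(not_vpos_root rd) nv.
have [pf|nf] := aroot_sign rfv.1; last first.
  apply: (vpos_root_neg rd _ nv); rewrite linearD /= act_delta.
  by apply: vposD; [exact: vpos_delta | apply: WS_pos => //; exact: (finrootN rfv).2].
have d0 : deg (act f1 v) = 0.
  have := deg_ge0 D rfv.2 pf => ge0.
  have [//|gt0] : deg (act f1 v) = 0 \/ 0 < deg (act f1 v) by lia.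
  have d1 := nottop2 _ rfv gt0 pv.
  by have /(vpos_root_neg rd)/(_ nv) := (local _ rfv d1).2 pv.
(* Bad roots being closed upwards, a bad root of degree 0 would make y bad; but y has degree 1,
   where [local] and the goodness of f1 apply. *)
have [|y [ry dy gy yx]] := finroot_above Pf1 rfv d0; first by rewrite cox_actK.
have py : vpos (act (phi (u' * f2)%g) (delta - y)).
  apply/(local _ ry dy); have := gd _ (finroot_act (parabolicV Pf1) ry) gy.
  by rewrite cox_actVK.
apply: (vpos_root_neg (aroot_act (phi (u' * f2)%g) (finroot_delta ry)) py).
rewrite (_ : delta - y = delta - act f1 v - (y - act f1 v)); last first.
  by apply/rowP => i; rewrite !mxE; ring.
rewrite linearB opprB /= addrC; apply: vposD => //.
by apply: WS_pos => //; apply: finiteB; [exact: ry.2 | exact: rfv.2].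
Qed.

Section Lengths.
Variables f1 f2 : G.
Hypotheses (Jf1 : WJ f1) (Jf2 : WJ f2) (gd : good (phi f2) f1).
Local Notation beta := (act f1 top).
Local Notation dg v := (deg (act f1^-1%g v)).

Let Pf1 : parabolic M Sfin f1 := Jf1.1.
Let Pf2 : parabolic M Sfin f2 := Jf2.1.

Definition bad x : Prop :=
  [/\ finroot x, vpos (- act (phi f2) (delta - x))
    & deg x = 1 \/ [/\ x = top, kap = 1 & vpos (- act f2 top)]].

(** For such x, [- act f1^-1 x] is an inversion of f1. *)
Definition target x : Prop := [/\ finroot x, vpos x & dg x < 0].

Lemma not_bad y : finroot y -> vpos (- act (phi f2) (delta - y)) -> dg y <= 0.
Proof.
move=> ry ny; rewrite leNgt; apply/negP => gy.
have := gd (finroot_act (parabolicV Pf1) ry) gy; rewrite cox_actVK => py.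
exact: vpos_root_neg (aroot_act _ (finroot_delta ry)) py ny.
Qed.

Lemma bad_up x y : vpos (- act (phi f2) (delta - x)) -> finite (y - x) ->
  vpos (y - x) -> vpos (- act (phi f2) (delta - y)).
Proof.
move=> nx fyx pyx; rewrite (_ : delta - y = delta - x - (y - x)); last first.
  by apply/rowP => i; rewrite !mxE; ring.
rewrite linearB opprB /= addrC; apply: vposD => //.
by apply: WS_pos => //; exact: WS_phi.
Qed.

Lemma bad_deg x : bad x -> deg x = 1 \/ deg x = 2 /\ x = top.
Proof. by case=> _ _ [->|[-> _ _]]; [left | right; rewrite deg_top]. Qed.

(** y is not bad, by [not_bad]. Were x - y negative, y would lie above the bad root x and so be
    bad. *)
Lemma bad_sub x y : bad x -> deg x = 1 -> finroot y -> deg y = 1 -> 0 < dg y ->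
  2 * aform x y = aform y y -> finroot (x - y) /\ vpos (x - y).
Proof.
move=> [rx nx _] dx ry dy gy e.
have rxy : finroot (x - y) by apply: finroot_sub => //; [exact: ry.2 | right; exact: ry.1].
split=> //; have [//|ngt] := aroot_sign rxy.1.
have := not_bad ry; rewrite leNgt gy => /(_ _)/negP[]//.
by apply: bad_up nx _ _; rewrite -opprB //; apply/finiteN/rxy.2.
Qed.

Lemma top_bad : kap = 1 -> vpos (- act (phi f2) (delta - top)).
Proof.
move=> k1; have := phi_top k1 (WS1 C) Jf2 (good1 Jf2); rewrite mul1g.
apply: not_vpos_root; exact/aroot_act/finroot_delta/top_finroot.
Qed.

Lemma target_map : exists h : V -> V, (forall x, bad x -> target (h x)) /\
  (forall x y, bad x -> bad y -> h x = h y -> x = y).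
Proof.
have Np := N_gt0 D; have c2 := dg_top D f1.
have badg x : bad x -> dg x <= 0 by case=> rx nx _; exact: not_bad.
have badp x : bad x -> vpos x.
  move=> bx; case: (bx) => rx _ _; apply: (@finroot_pos _ _ _ D _ rx).
  by case: (bad_deg bx) => [->|[-> _]].
have badr x : bad x -> finroot x by case.
case: (deg_beta_cases D Pf1) => [[c bE]|[c bE]|c0|[c1 k1]].
- have absurd x : bad x -> False.
    move=> bx; have := badg x bx; have := aform_beta D f1 x; rewrite bE aform_top.
    by case: (bad_deg bx) => [->|[-> _]]; nia.
  by exists id; split=> x => [/absurd|y /absurd].
- exists id; split=> // x bx; split; [exact: badr | exact: badp |].
  have := aform_beta D f1 x; rewrite bE aformNr aform_top.
  by case: (bad_deg bx) => [->|[-> _]]; nia.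
- have [x1 [x2 [[r1 d1 g1] [r2 d2 g2] x12 pick disj]]] := deg_beta0_pair Pf1 c0.
  (* With relative degree 0, [top] goes to top - (x1 + x2) = - beta, and any other root is lowered
     by whichever of x1, x2 makes the difference a root. *)
  pose h x := if dg x < 0 then x else if x == top then - beta else
    if 2 * aform x x1 == aform x1 x1 then x - x1 else x - x2.
  exists h.
  have hP x : bad x -> [\/ h x = x /\ dg x < 0, [/\ x = top, h x = - beta & kap = 1],
      [/\ deg x = 1, dg x = 0, 2 * aform x x1 = aform x1 x1 & h x = x - x1]
    | [/\ deg x = 1, dg x = 0, 2 * aform x x1 <> aform x1 x1,
          2 * aform x x2 = aform x2 x2 & h x = x - x2]].
    move=> bx; have := badg x bx; rewrite /h; case: ltP => [gx _|ge0 le0].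
      by constructor 1.
    have gx : dg x = 0 by lia.
    case: eqP => [xt|nt].
      by constructor 2; split=> //; case: bx => _ _ [dx|[]//]; move: dx; rewrite xt deg_top.
    have dx : deg x = 1 by case: (bad_deg bx) => [//|[_ /nt]].
    case: eqP => [e|e]; first by constructor 3.
    constructor 4; split=> //.
    by have [|/e|] := pick x (badr x bx); first by rewrite dx gx.
  split=> [x bx|x y bx by_].
    case: (hP x bx) => [[-> gx]|[xt -> k1]|[dx gx e ->]|[dx gx _ e ->]].
    - by split=> //; [exact: badr | exact: badp].
    - have rb : finroot beta by split; [exact: beta_root | exact: beta_finite].
      split; [exact: finrootN | | by rewrite dgN dg_beta].
      have [pb|//] := aroot_sign rb.1.
      (* As [top] is an inversion of f2 and x1 is not bad, [phi f2] makes delta - (top - x1)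
         negative. If beta were positive, x2 = (top - x1) + beta would be bad too, although its
         relative degree is 1. *)
      have nf2 : vpos (- act f2 top).
        by case: bx => _ _ [dx|[]//]; move: dx; rewrite xt deg_top.
      have taut y : deg y = 1 -> tau (delta - y) = top - y.
        move=> dy; rewrite (tau1 k1) degB deg_delta dy.
        by apply/rowP => i; rewrite !mxE; ring.
      have pos1 : vpos (act (phi f2) (delta - x1)).
        have := gd (finroot_act (parabolicV Pf1) r1); rewrite cox_actVK.
        by apply; rewrite g1.
      have : dg x2 <= 0; last by rewrite g2.
      apply: not_bad => //; apply: (@bad_up (top - x1)).
      + rewrite phi_act_neg taut; last by rewrite degB deg_top d1.
        rewrite linearB /= opprB addrC.
        by apply: vposD => //; rewrite -taut //; apply/phi_act.
      + rewrite (_ : _ - _ = beta); first exact: rb.2.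
        by apply: (addrI top); rewrite -x12; apply/rowP => i; rewrite !mxE; ring.
      + rewrite (_ : _ - _ = beta) //.
        by apply: (addrI top); rewrite -x12; apply/rowP => i; rewrite !mxE; ring.
    - have [] := bad_sub bx dx r1 d1 _ e; first by rewrite g1.
      by move=> rs ps; split=> //; rewrite dgB gx g1.
    - have [] := bad_sub bx dx r2 d2 _ e; first by rewrite g2.
      by move=> rs ps; split=> //; rewrite dgB gx g2.
  have dgb : dg (- beta) = -2 by rewrite dgN dg_beta.
  have degb : deg (- beta) = 0 by rewrite degN c0.
  have dpos z : bad z -> 0 < deg z by move=> /bad_deg[->|[-> _]].
  have [dpx dpy] := (dpos _ bx, dpos _ by_).
  case: (hP x bx) => [[-> gx]|[xt -> _]|[dx gx ex ->]|[dx gx nex ex ->]];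
  case: (hP y by_) => [[-> gy]|[yt -> _]|[dy gy ey ->]|[dy gy ney ey ->]] // E.
  (* The pair (deg, dg) of the image separates all cases but x - x1 and x - x2, which [disj] keeps
     apart. *)
  all: try by exfalso; move: (congr1 deg E) (congr1 (fun z => dg z) E);
    rewrite ?degB ?dgB ?degb ?dgb ?d1 ?d2 ?g1 ?g2; lia.
  + by rewrite xt yt.
  + exact: (addIr (- x1)).
  + by case: ney; apply: (disj x y) => //; rewrite ?dx ?dy ?gx ?gy.
  + by case: nex; apply: (disj y x) => //; rewrite ?dx ?dy ?gx ?gy.
  + exact: (addIr (- x2)).
have rt := top_finroot k1.
(* The relative degree of [top] equals [deg beta]; it cannot be 1 since [top] is bad. *)
have c1' : deg beta = -1.
  case: c1 => // c1; have := not_bad rt (top_bad k1).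
  by rewrite c2 c1.
pose kp := top + beta.
have rk : finroot kp.
  rewrite /kp addrC -[X in _ + X]opprK -[- top]scaleN1r; apply: finroot_reflect => //.
  - by split; [exact: beta_root | exact: beta_finite].
  - exact: top0.
  - by left; exact: topL.
  by rewrite !aform_top deg_top c1'; ring.
have dk : deg kp = 1 by rewrite degD deg_top c1'.
have gk : dg kp = 1 by rewrite dgD dg_beta c2 c1'.
exists (fun x => if dg x < 0 then x else x - kp); split=> [x bx|x y bx by_].
  case: ltP => gx; first by split=> //; [exact: badr | exact: badp].
  have {}gx : dg x = 0 by have := badg x bx; lia.
  have dx : deg x = 1.
    by case: (bad_deg bx) => [//|[_ xt]]; move: gx; rewrite xt c2 c1'.
  have [] := bad_sub bx dx rk dk _ _; first by rewrite gk.
    rewrite /kp !aformL (aformC _ beta top) !aform_top !aform_beta.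
    by rewrite dx gx deg_top dg_beta c2 c1'; ring.
  by move=> rs ps; split=> //; rewrite dgB gx gk.
have dpos z : bad z -> 0 < deg z by move=> /bad_deg[->|[-> _]].
have [dpx dpy] := (dpos _ bx, dpos _ by_).
have dg1 z : bad z -> 0 <= dg z -> deg z = 1.
  by move=> bz; case: (bad_deg bz) => [//|[_ ->]]; rewrite c2 c1'.
case: ltP => gx; case: ltP => gy // E; last exact: (addIr (- kp)).
  by have := congr1 deg E; rewrite degB dk (dg1 y) // subrr; lia.
by have := congr1 deg E; rewrite degB dk (dg1 x) // subrr; lia.
Qed.

Theorem good_len : (cox_len f2 <= cox_len f1)%N.
Proof.
have [s1 [us1 <- s1P]] := inversions C f1; have [s2 [us2 <- s2P]] := inversions C f2.
have [h [hT hI]] := target_map.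
pose mu v := if deg v == 1 then delta - tau v else top.
have inv2 v : v \in s2 -> [/\ finroot v, 0 < deg v & vpos (- act f2 v)].
  move=> /s2P[rv pv nv].
  have fv : finite v.
    apply/eqP; rewrite eq_le; have := pv ord0; have := nv ord0.
    by rewrite mxE coord0_act // oppr_ge0 => -> ->.
  (* An inversion of degree 0 would be supported on simple roots of degree 0, which f2 in W^J keeps
     positive. *)
  split=> //; have := deg_ge0 D fv pv; rewrite le_eqVlt => /orP[/eqP d0|//].
  exfalso; apply: (vpos_root_neg (aroot_act f2 rv) _ nv).
  have term0 : forall i, true -> 0 <= v 0 i * deg (sroot i).
    move=> i _; case: (boolP (Sfin i)) => Si; last by rewrite finite_supported ?mul0r.
    by rewrite mulr_ge0 ?deg_sroot.
  have := psumr_eq0P term0; rewrite -deg_sum -d0 => /(_ erefl) vi0.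
  apply: (@act_pos_comb _ _ _ (fun i => Sfin i && (deg (sroot i) == 0))) => //.
    by move=> k /andP[Sk /eqP dk]; exact: Jf2.2.
  move=> i; rewrite negb_and => /orP[Si|di]; first exact: finite_supported.
  by have /eqP := vi0 i isT; rewrite mulf_eq0 (negbTE di) orbF => /eqP.
have muB v : v \in s2 -> bad (mu v).
  move=> /inv2[rv dv nv]; rewrite /mu; case: eqP => [d1|d1].
    have [rt dt _] := tau_deg1 rv d1; split=> //; last by left.
    by rewrite subKr phi_act_neg tauK.
  have [//|[vt k1]] := deg_finroot_cases rv dv.
  split; [exact: top_finroot | exact: top_bad |].
  by right; split=> //; rewrite -vt.
have muI v y : v \in s2 -> y \in s2 -> mu v = mu y -> v = y.
  move=> /inv2[rv dv _] /inv2[rw dw _] E; have := congr1 deg E; move: E.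
  rewrite /mu; case: eqP => d1; case: eqP => d2.
  - by move/(addrI _)/oppr_inj/(inv_inj (tauK D)).
  - by have [_ -> _] := tau_deg1 rv d1; rewrite deg_top.
  - by have [_ -> _] := tau_deg1 rw d2; rewrite deg_top.
  - have [//|[-> _]] := deg_finroot_cases rv dv.
    by have [//|[-> _]] := deg_finroot_cases rw dw.
pose F v := - act f1^-1%g (h (mu v)).
rewrite -(size_map F s2); apply: uniq_leq_size.
  rewrite map_inj_in_uniq // => v w vs ws /oppr_inj/(can_inj (cox_actVK C f1)).
  by move/(hI _ _ (muB _ vs) (muB _ ws)); exact: muI.
move=> x /mapP[v vs ->]; have [rh ph gh] := hT _ (muB _ vs).
apply/s1P; have rF : finroot (F v) by apply/finrootN/finroot_act => //; exact: parabolicV.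
split; first exact: rF.1.
  by apply: (@finroot_pos _ _ _ D _ rF); rewrite degN oppr_gt0.
by rewrite /F linearN /= opprK cox_actVK.
Qed.

End Lengths.
End Steps.

(** * Canonical factorizations *)

Lemma affine_partitions_cons (sg : cpart -> Prop) (al : cpart -> cpart -> Prop) a p :
  affine_partitions sg al (a :: p) <->
  [/\ (0 < a.1)%N, sg a, affine_partitions sg al p
    & forall b p', p = b :: p' -> (b.1 <= a.1)%N /\ al b a].
Proof.
split=> [[[pos srt seg] alw]|[a0 sa [[pos srt seg] alw] hd]].
  split; [exact/pos/mem_head | exact/seg/mem_head | split; first split |].
  - by move=> b bp; apply: pos; rewrite inE bp orbT.
  - exact: path_sorted srt.
  - by move=> b bp; apply: seg; rewrite inE bp orbT.
  - by move=> t tp; exact: (alw t.+1).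
  - move=> b p' pE; move: srt (alw 0%N); rewrite pE => /= /andP[ba _].
    by move=> /(_ isT).
split; first split.
- by move=> b; rewrite inE => /orP[/eqP->|/pos].
- case: p pos srt seg alw hd => [//|b p] _ srt _ _ hd /=.
  by apply/andP; split; [have [] := hd b p erefl|].
- by move=> b; rewrite inE => /orP[/eqP->|/seg].
- case=> [|t] tp; last exact: alw.
  by case: p {pos srt seg alw} hd tp => [//|b p] hd _; have [] := hd b p erefl.
Qed.

Section Bijection.
Variables (n : nat) (M : 'I_n.+1 -> 'I_n.+1 -> nat) (C : affine_datum M).
Variable D : grading C.
Local Notation G := (coxgroup M).
Local Notation act := (@cox_act n M C).
Local Notation phi := (@phi n M C D).
Local Notation WS := (@WS n M).
Local Notation WJ := (WJ D).
Local Notation eps := (eps D).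
Local Notation good := (good D).
Local Notation len := (@cox_len _ M).
Implicit Types (u w x : G) (a b : cpart) (p : seq cpart).
Variable f : nat -> seq G.
Hypothesis fP : forall j, uniq (f j) /\ forall x, x \in f j <-> WJ x /\ len x = j.

Definition enc x : cpart := ((len x + eps)%N, (index x (f (len x))).+1).
Definition dcd a : G := nth 1%g (f (a.1 - eps)%N) a.2.-1.
Definition seg a : Prop := (eps <= a.1)%N /\ (0 < a.2 <= size (f (a.1 - eps)%N))%N.
(** Both kinds of allowed pair in one formula: for finite factors x, y, [phi (phi x * y)] is (x
    s_0)(y s_0) in Type I and x times the twist of y in Type II. *)
Definition allow a b : Prop :=
  WS (phi (phi (dcd a) * dcd b)%g) /\
  len (phi (phi (dcd a) * dcd b)%g) = (a.1 + b.1)%N.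

Fixpoint fact (k : nat) w : seq cpart :=
  if k isn't k'.+1 then [::] else
  if w == 1%g then [::] else
  enc (v_part Sfin (phi w)) :: fact k' (u_part Sfin (phi w)).

Definition dec p : G := foldr (fun a u => phi (u * dcd a)%g) 1%g p.

Lemma enc_seg x : WJ x -> seg (enc x) /\ dcd (enc x) = x.
Proof.
move=> Jx; have [_ /(_ x)[_ /(_ (conj Jx erefl)) xf]] := fP (len x).
by rewrite /seg /dcd /enc /= addnK leq_addl nth_index // index_mem.
Qed.

Lemma dcd_seg a : seg a -> [/\ WJ (dcd a), a.1 = (len (dcd a) + eps)%N & enc (dcd a) = a].
Proof.
case: a => j c [/= le_ej /andP[c0 cs]].
have cs' : (c.-1 < size (f (j - eps)))%N by rewrite prednK.
have [uf ff] := fP (j - eps)%N.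
have [Jx lx] := (ff _).1 (mem_nth 1%g cs').
split=> //; first by rewrite lx subnK.
by rewrite /enc /dcd lx subnK //= index_uniq // prednK.
Qed.

Lemma len_phi_WJ x : WJ x -> len (phi x) = (len x + eps)%N.
Proof.
move=> Jx; have [_] := (goodP (WS1 C) Jx).2 (good1 Jx).
by rewrite mul1g cox_len1 add0n.
Qed.

Lemma allowP a b : seg a -> seg b -> allow a b <-> good (phi (dcd a)) (dcd b).
Proof.
move=> sa sb; have [Ja a1 _] := dcd_seg sa; have [Jb b1 _] := dcd_seg sb.
rewrite -goodP //; last exact: WS_phi.
by rewrite /allow (len_phi_WJ Ja) -a1 b1 addnA.
Qed.

(** A nontrivial w in W~^S descends at s_0. In Type I this makes [phi w] shorter; in Type II it
    forces the finite factor to be nontrivial. Either way the recursion ends. *)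
Lemma WS_step w : WS w -> w <> 1%g ->
  let u := u_part Sfin (phi w) in let v := v_part Sfin (phi w) in
  [/\ WS u, WJ v, good u v, w = phi (u * v)%g
    & len w = (len u + len v + eps)%N /\ (0 < len v + eps)%N].
Proof.
move=> Sw w1 /=; have [mu Pv uv lw'] := par_partP C Sfin (phi w).
set u := u_part _ _ in mu uv lw' *; set v := v_part _ _ in Pv uv lw' *.
have mw := (min_repP C _ _).1 Sw.
have Jv : WJ v.
  split=> // k Sk dk.
  have rk : finroot C (sroot k).
    by split; [exact: aroot_sroot | rewrite /finite srootE; case: eqP Sk => // ->].
  apply/(WS_sign mu (finroot_act Pv rk)); rewrite -cox_actM -uv; apply/phi_act.
  by have [l [Sl _ ->]] := tau_J Sk dk; exact: mw.
have desc0 : ~ vpos (act w (sroot ord0)).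
  move=> p0; apply: w1; apply: (@cox_no_descent _ _ C) => i.
  case: (boolP (Sfin i)) => [/mw//|]; rewrite /Sfin lt0n negbK => /eqP i0.
  by rewrite (_ : i = ord0) //; apply: val_inj.
have lw : len w = (len u + len v + eps)%N.
  rewrite -lw' -{1}[w](phiK D); apply/(cox_len_eps D) => k1.
  rewrite -(top1 k1) (phi1 k1) act_gen_sroot.
  by have [|//] := act_sroot_sign C w ord0; move/desc0.
have wE : w = phi (u * v)%g by rewrite -uv phiK.
split=> //; last split=> //.
  by apply/goodP => //; rewrite -wE.
have [k1|k2] := kapP D; first by rewrite (eps1 k1) addn1.
rewrite lt0n; apply/eqP => l0; apply: desc0.
have v1 : v = 1%g by apply: cox_len_eq0; lia.
have [k Sk tk] := tau2 k2.
by rewrite -tk; apply/phi_act; rewrite uv v1 mulg1; exact: ((min_repP C _ _).1 mu).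
Qed.

Lemma WS_step_inv u x : WS u -> WJ x -> good u x -> (0 < len x + eps)%N ->
  let w := phi (u * x)%g in
  [/\ WS w, w <> 1%g, len w = (len u + len x + eps)%N,
      u_part Sfin (phi w) = u & v_part Sfin (phi w) = x].
Proof.
move=> mu Jx gd pos w; have [mw lw] := (goodP mu Jx).2 gd.
have [Px _] := Jx.
split=> //; first by move=> w1; move: lw; rewrite -/w w1 cox_len1; lia.
  by rewrite /w phiK (u_partE C).
by rewrite /w phiK (v_partE C).
Qed.

Lemma fact_spec k w : WS w -> (len w <= k)%N ->
  [/\ affine_partitions seg allow (fact k w), dec (fact k w) = w
    & (\sum_(a <- fact k w) a.1)%N = len w].
Proof.
elim: k w => [|k IH] w Sw le_wk.
  have -> : w = 1%g by apply: cox_len_eq0; apply/eqP; rewrite -leqn0.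
  by rewrite big_nil cox_len1.
rewrite /=; case: eqP => [->|w1]; first by rewrite big_nil cox_len1.
have [mu Jv gd wE [lw pos]] := WS_step Sw w1.
set u := u_part _ _ in mu gd wE lw *; set v := v_part _ _ in Jv gd wE lw pos *.
have le_uk : (len u <= k)%N.
  have : (len u < len w)%N by rewrite lw -addnA -{1}[len u]addn0 ltn_add2l.
  by move=> lt_uw; rewrite -ltnS (leq_trans lt_uw).
have [Pu du su] := IH u mu le_uk; have [sv dv] := enc_seg Jv.
split.
- apply/affine_partitions_cons; split=> // b p' pE.
  case: k pE {IH le_wk Pu du su} le_uk => [//|k] /=; case: eqP => // u1 [<- _] _.
  have [mu' Jv' gd' uE _] := WS_step mu u1.
  set u' := u_part _ _ in mu' gd' uE *; set v' := v_part _ _ in Jv' gd' uE *.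
  (* Locality discards u', leaving a condition on two consecutive segments; it also orders their
     lengths, by [good_len]. *)
  have g' : good (phi v') v by apply/(good_local mu') => //; rewrite -uE.
  have [sv' dv'] := enc_seg Jv'.
  split; first by rewrite /= leq_add2r; exact: good_len g'.
  by apply/allowP => //; rewrite dv dv'.
- by rewrite /= -/(dec _) du dv.
- by rewrite big_cons su lw /= addnC addnA.
Qed.

(** Locality in the other direction: conditions on consecutive pairs propagate to the whole
    product. *)
Lemma dec_spec p : affine_partitions seg allow p ->
  WS (dec p) /\
  (forall a p', p = a :: p' -> WS (dec p') /\ good (dec p') (dcd a)).
Proof.
elim: p => [|a p IH]; first by split=> //; exact: WS1.
move=> /affine_partitions_cons[a0 sa Pp hd]; have [mp gp] := IH Pp.
have [Ja a1 _] := dcd_seg sa.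
have gd : good (dec p) (dcd a).
  case: p Pp mp gp hd {IH} => [|b p] Pp mp gp hd; first exact: good1.
  have [_ alw] := hd b p erefl; have [_ sb _ _] := (affine_partitions_cons _ _ _ _).1 Pp.
  have [Jb _ _] := dcd_seg sb; have [mp' gb] := gp b p erefl.
  by apply/(good_local mp') => //; apply/allowP.
split; last by move=> _ _ [<- <-].
by have [] := (goodP mp Ja).2 gd.
Qed.

Lemma fact_dec p k : affine_partitions seg allow p -> (len (dec p) <= k)%N ->
  fact k (dec p) = p.
Proof.
elim: p k => [|a p IH] k Pp; first by case: k => //= k _; rewrite eqxx.
have [_ /(_ a p erefl)[mp gd]] := dec_spec Pp.
have [a0 sa {}Pp _] := (affine_partitions_cons _ _ _ _).1 Pp.
have [Ja a1 ea] := dcd_seg sa.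
have [|mw w1 lw uw vw] := WS_step_inv mp Ja gd; first by rewrite -a1.
rewrite [dec _]/= -/(dec p) in mw w1 lw *.
case: k => [|k]; first by rewrite leqn0 => /eqP/cox_len_eq0/w1.
rewrite lw -addnA -a1 /= => le_k; case: eqP => // _.
rewrite uw vw ea IH //; move: le_k a0; lia.
Qed.

Theorem fact_bij (pi : G -> seq cpart) (P : set (seq cpart)) :
  (forall w, pi w = fact (len w) w) -> P = affine_partitions seg allow ->
  set_bij (min_rep M Sfin) P pi /\
  forall w, WS w -> (\sum_(a <- pi w) a.1)%N = len w.
Proof.
move=> piE ->; split; last by move=> w Sw; rewrite piE; have [] := fact_spec Sw (leqnn _).
split.
- by move=> w Sw; rewrite piE; have [] := fact_spec Sw (leqnn _).
- move=> w w' /set_mem Sw /set_mem Sw'; rewrite !piE => e.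
  have [_ <- _] := fact_spec Sw (leqnn _); rewrite e.
  by have [] := fact_spec Sw' (leqnn _).
- move=> p Pp; exists (dec p); first by have [] := dec_spec Pp.
  by rewrite piE fact_dec.
Qed.

End Bijection.

(** * Affine Dynkin diagrams *)

Section Diagrams.
Local Open Scope nat_scope.

(** The diagram data are functions on natural numbers, so that the exceptional types are checked by
    computation and the families by linear arithmetic. *)
Definition coxn X (i j : nat) : nat :=
  if i == j then 1 else
  head 2 [seq b.2 | b <- affine_bonds X & (b.1 == (i, j)) || (b.1 == (j, i))].

Definition hsqn X (i : nat) : nat :=
  match X with
  | affB n => if i == n then 1 else 2
  | affC n => if (i == 0) || (i == n) then 2 else 1
  | affF4 => if i < 3 then 2 else 1
  | affG2 => if i < 2 then 3 else 1
  | _ => 1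
  end.

Definition markn X (i : nat) : nat :=
  match X with
  | affA _ => 1
  | affB _ => if i < 2 then 1 else 2
  | affC n => if (i == 0) || (i == n) then 1 else 2
  | affD n => if (i < 2) || (n.-1 <= i) then 1 else 2
  | affE6 => nth 1 [:: 1; 2; 3; 2; 1; 2; 1] i
  | affE7 => nth 1 [:: 1; 2; 3; 4; 3; 2; 1; 2] i
  | affE8 => nth 1 [:: 1; 2; 3; 4; 5; 6; 4; 2; 3] i
  | affF4 => nth 1 [:: 1; 2; 3; 4; 2] i
  | affG2 => nth 1 [:: 1; 2; 3] i
  end.

Definition ration X : nat :=
  match X with affB _ | affC _ | affF4 => 2 | affG2 => 3 | _ => 1 end.

(** For adjacent vertices d_i a_ij is minus the larger of d_i and d_j, doubled for the infinite
    bond. *)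
Definition cartm (m di dj : nat) : int :=
  match m with
  | 0 => - (2 * (maxn di dj %/ di)%:Z)
  | 1 => 2
  | 2 => 0
  | _ => - (maxn di dj %/ di)%:Z
  end%R.

Definition cartn X i j := cartm (coxn X i j) (hsqn X i) (hsqn X j).

(* A spanning tree of the diagram rooted at s_0, with a decreasing measure. *)
Definition parent X (i : nat) : nat :=
  match X with
  | affB _ => if i == 1 then 2 else if i == 2 then 0 else i.-1
  | affD n => if i == 1 then 2 else if i == 2 then 0 else
              if i == n then n.-2 else i.-1
  | affE6 => if i == 5 then 2 else i.-1
  | affE7 => if i == 7 then 3 else i.-1
  | affE8 => if i == 8 then 5 else i.-1
  | _ => i.-1
  end.

Definition depth X (i : nat) : nat :=
  match X with
  | affB _ | affD _ => if i == 1 then 2 else if i == 2 then 1 else i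
  | _ => i
  end.

Definition local_ok X i j : bool :=
  (i == j) || bond_ok (coxn X i j) (cartn X i j) (cartn X j i).

Definition vertex_ok X i : bool :=
  (ration X %| hsqn X i * markn X i) &&
  ((0 < i) ==> [&& parent X i <= affine_rank X, cartn X i (parent X i) != 0%R
                 & depth X (parent X i) < depth X i]).

Definition row_ok X i : bool :=
  (\sum_(j < (affine_rank X).+1) cartn X i j * (markn X j)%:Z)%R == 0%R.

Definition diagram_ok X : Prop := forall i, i <= affine_rank X ->
  [/\ forall j, j <= affine_rank X -> local_ok X i j, vertex_ok X i & row_ok X i].

Lemma sum_ord_foldr (F : nat -> int) N :
  (\sum_(j < N) F j = foldr (fun j s => F j + s) 0 (iota 0 N))%R.
Proof.
rewrite -(big_mkord xpredT F) /index_iota subn0.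
by elim: (iota 0 N) => [|j s IH] /=; rewrite ?big_nil // big_cons IH.
Qed.

Definition check X : bool :=
  let r := iota 0 (affine_rank X).+1 in
  all (fun i => [&& all (local_ok X i) r, vertex_ok X i
    & foldr (fun j s => cartn X i j * (markn X j)%:Z + s)%R 0%R r == 0%R]) r.

Lemma check_ok X : check X -> diagram_ok X.
Proof.
move=> /allP ck i iN; have := ck i; rewrite mem_iota => /(_ iN)/and3P[/allP lo vo ro].
split=> //; first by move=> j jN; apply: lo; rewrite mem_iota.
by rewrite /row_ok (sum_ord_foldr (fun j => cartn X i j * (markn X j)%:Z)%R).
Qed.

Lemma sum_support (F : nat -> int) (N : nat) (l : seq nat) : uniq l ->
  all (fun j => j < N) l -> (forall j, j < N -> j \notin l -> F j = 0%R) ->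
  (\sum_(j < N) F j = \sum_(j <- l) F j)%R.
Proof.
move=> ul /allP lN F0; rewrite -(big_mkord xpredT F) /index_iota subn0.
rewrite (bigID (mem l)) /= [X in (_ + X)%R]big1_seq ?addr0; last first.
  by move=> j /andP[jl]; rewrite mem_iota => /andP[_ jN]; exact: F0.
rewrite -big_filter; apply: perm_big; apply: uniq_perm => //.
  by rewrite filter_uniq ?iota_uniq.
move=> j; rewrite mem_filter mem_iota /=; case jl: (j \in l) => //=.
by rewrite add0n lN.
Qed.

Lemma head_path (a b i j : nat) :
  head 2 [seq c.2 | c <- simple_path a b & (c.1 == (i, j)) || (c.1 == (j, i))] =
  if (a <= i < b) && (j == i.+1) || (a <= j < b) && (i == j.+1) then 3 else 2.
Proof.
rewrite /simple_path.
have [k] : exists k, b - a = k by exists (b - a).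
elim: k a => [|k IH] a ab; rewrite ab /=; first by case: ifP => //; lia.
rewrite !xpair_eqE; case: ifP => c /=; first by case: ifP => //; lia.
have := IH a.+1; rewrite (_ : b - a.+1 = k); last by lia.
move=> -> //; congr (if _ then _ else _); lia.
Qed.

Lemma coxn_sym X i j : coxn X i j = coxn X j i.
Proof.
rewrite /coxn eq_sym; congr (if _ then _ else head _ [seq _ | b <- _]).
by apply: eq_filter => b; rewrite orbC.
Qed.

Lemma head_cons (p : pred (nat * nat * nat)) c l :
  head 2 [seq b.2 | b <- c :: l & p b] = if p c then c.2 else head 2 [seq b.2 | b <- l & p b].
Proof. by rewrite /=; case: (p c). Qed.

End Diagrams.

Ltac ifd := repeat match goal with
  | |- context [if ?c then _ else _] =>
    first [have -> : c = true by lia | have -> : c = false by lia]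
  end.
Ltac ifs := repeat (case: ifP => ?; try (exfalso; lia)).

(** * The infinite families of diagrams *)

Section Families.
Local Open Scope nat_scope.
Variable n : nat.

Lemma coxnA i j : 1 < n -> coxn (affA n) i j =
  if i == j then 1 else if (n == i) && (0 == j) || (n == j) && (0 == i) then 3 else
  if (i < n) && (j == i.+1) || (j < n) && (i == j.+1) then 3 else 2.
Proof.
rewrite /coxn /affine_bonds; case: n => [|[|m]] // _.
by rewrite head_cons head_path !xpair_eqE.
Qed.

Lemma coxnB i j : coxn (affB n) i j =
  if i == j then 1 else if (0 == i) && (2 == j) || (0 == j) && (2 == i) then 3 else
  if (1 == i) && (2 == j) || (1 == j) && (2 == i) then 3 else
  if (n.-1 == i) && (n == j) || (n.-1 == j) && (n == i) then 4 else
  if (2 <= i < n.-1) && (j == i.+1) || (2 <= j < n.-1) && (i == j.+1) then 3 else 2.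
Proof. by rewrite /coxn /affine_bonds !head_cons head_path !xpair_eqE. Qed.

Lemma coxnC i j : coxn (affC n) i j =
  if i == j then 1 else if (0 == i) && (1 == j) || (0 == j) && (1 == i) then 4 else
  if (n.-1 == i) && (n == j) || (n.-1 == j) && (n == i) then 4 else
  if (1 <= i < n.-1) && (j == i.+1) || (1 <= j < n.-1) && (i == j.+1) then 3 else 2.
Proof. by rewrite /coxn /affine_bonds !head_cons head_path !xpair_eqE. Qed.

Lemma coxnD i j : coxn (affD n) i j =
  if i == j then 1 else if (0 == i) && (2 == j) || (0 == j) && (2 == i) then 3 else
  if (1 == i) && (2 == j) || (1 == j) && (2 == i) then 3 else
  if (n.-2 == i) && (n.-1 == j) || (n.-2 == j) && (n.-1 == i) then 3 else
  if (n.-2 == i) && (n == j) || (n.-2 == j) && (n == i) then 3 else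
  if (2 <= i < n.-2) && (j == i.+1) || (2 <= j < n.-2) && (i == j.+1) then 3 else 2.
Proof. by rewrite /coxn /affine_bonds !head_cons head_path !xpair_eqE. Qed.

Lemma row_support X i (l : seq nat) : uniq l ->
  all (fun j => j <= affine_rank X) l ->
  (forall j, j <= affine_rank X -> j \notin l -> coxn X i j = 2) ->
  (\sum_(j <- l) cartn X i j * (markn X j)%:Z)%R = 0%R -> row_ok X i.
Proof.
move=> ul lN l2 s0; apply/eqP.
rewrite (@sum_support (fun j => cartn X i j * (markn X j)%:Z)%R (affine_rank X).+1 l) //.
by move=> j jN jl; rewrite /cartn l2 // mul0r.
Qed.

Lemma diagram_okA : 1 < n -> diagram_ok (affA n).
Proof.
move=> n1 i /= iN; split=> [j jN||].
- by rewrite /local_ok /cartn (coxn_sym _ j) !coxnA //; ifs.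
- apply/andP; split=> //; apply/implyP => i0; rewrite /= /cartn coxnA //.
  by apply/and3P; split; [lia | ifs | lia].
(* The vertex i with its neighbours; all other terms of the row vanish. *)
pose l := if i == 0 then [:: n; 0; 1] else
  if i == n then [:: n.-1; n; 0] else [:: i.-1; i; i.+1].
apply: (row_support (l := l)); rewrite /l /=.
- by ifs; rewrite /= !inE; lia.
- by ifs; rewrite /=; lia.
- by move=> j jN; ifs; rewrite !inE coxnA // => jl; ifd; lia.
by ifs; rewrite !big_cons big_nil /cartn !coxnA //; ifs.
Qed.

Lemma diagram_okC : 1 < n -> diagram_ok (affC n).
Proof.
move=> n1 i /= iN; split=> [j jN||].
- by rewrite /local_ok /cartn /= (coxn_sym _ j) coxnC; ifs.
- apply/andP; split; rewrite /=; first by ifs.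
  apply/implyP => i0; rewrite /cartn /= coxnC //.
  by apply/and3P; split; [lia | ifs | lia].
pose l := if i == 0 then [:: 0; 1] else if i == n then [:: n.-1; n] else [:: i.-1; i; i.+1].
apply: (row_support (l := l)); rewrite /l /=.
- by ifs; rewrite /= ?inE; lia.
- by ifs; rewrite /=; lia.
- by move=> j jN; ifs; rewrite !inE coxnC // => jl; ifd; lia.
have [e|e] := eqVneq i.+1 n; have [e'|e'] := eqVneq i 1;
  by ifs; rewrite !big_cons big_nil /cartn /= !coxnC //; ifd.
Qed.

Lemma diagram_okB : 2 < n -> diagram_ok (affB n).
Proof.
move=> n1 i /= iN; split=> [j jN||].
- by rewrite /local_ok /cartn /= (coxn_sym _ j) coxnB; ifs.
- apply/andP; split; rewrite /=; first by ifs.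
  apply/implyP => i0; set p := (if i == 1 then _ else _).
  have pP : i = 1 /\ p = 2 \/ i = 2 /\ p = 0 \/ 2 < i /\ p = i.-1.
    by rewrite /p; ifs; lia.
  apply/and3P; split; first by lia.
    rewrite /cartn /= coxnB; move: p pP => p {i0}.
    have [e|e] := eqVneq i n;
      by do ?[case=> [[? ?]|]|case=> ? ?]; ifd.
  by ifs; lia.
pose l := if i < 2 then [:: i; 2] else if i == 2 then [:: 0; 1; 2; 3] else
  if i == n then [:: n.-1; n] else [:: i.-1; i; i.+1].
apply: (row_support (l := l)); rewrite /l /=.
- by ifs; rewrite /= ?inE; lia.
- by ifs; rewrite /=; lia.
- by move=> j jN; ifs; rewrite !inE coxnB // => jl; ifd; lia.
have [e|e] := eqVneq i.+1 n; have [z|z] := eqVneq i 0;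
  by ifs; rewrite !big_cons big_nil /cartn /= !coxnB //; ifd.
Qed.

Lemma diagram_okD : 3 < n -> diagram_ok (affD n).
Proof.
move=> n1 i /= iN; split=> [j jN||].
- by rewrite /local_ok /cartn /= (coxn_sym _ j) coxnD; ifs.
- apply/andP; split=> //; rewrite /=.
  apply/implyP => i0; set p := (if i == 1 then _ else _).
  have pP : i = 1 /\ p = 2 \/ i = 2 /\ p = 0 \/ i = n /\ p = n.-2 \/
      2 < i < n /\ p = i.-1.
    by rewrite /p; ifs; lia.
  apply/and3P; split; first by lia.
    rewrite /cartn /= coxnD; move: p pP => p {i0}.
    have [e|e] := eqVneq i n.-1;
      by do ?[case=> [[? ?]|]|case=> ? ?]; ifd.
  by ifs; lia.
(* For n = 4 the vertex 2 is also n - 2 and meets both forks. *)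
pose l := if i < 2 then [:: i; 2] else if n.-1 <= i then [:: n.-2; i] else
  if i == 2 then (if n == 4 then [:: 0; 1; 2; 3; 4] else [:: 0; 1; 2; 3]) else
  if i == n.-2 then [:: n.-1.-2; n.-2; n.-1; n] else [:: i.-1; i; i.+1].
apply: (row_support (l := l)); rewrite /l /=.
- by ifs; rewrite /= ?inE; lia.
- by ifs; rewrite /=; lia.
- by move=> j jN; ifs; rewrite !inE coxnD // => jl; ifd; lia.
have [e|e] := eqVneq i n; have [z|z] := eqVneq i 0;
  by ifs; rewrite !big_cons big_nil /cartn /= !coxnD //; ifd.
Qed.

End Families.

Lemma affine_diagram_ok X : affine_ok X -> diagram_ok X.
Proof.
case: X => [n|n|n|n|||||] /= nX; try by apply: check_ok; vm_compute.
- case: n nX => [//|[_|n _]]; last exact: diagram_okA.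
  by apply: check_ok; vm_compute.
- exact: diagram_okB.
- exact: diagram_okC.
- exact: diagram_okD.
Qed.


Lemma affine_coxE X (i j : 'I_(affine_rank X).+1) : affine_cox i j = coxn X i j.
Proof. by rewrite /affine_cox /coxn -(inj_eq val_inj). Qed.

Lemma hsqn_cases X i : hsqn X i = 1%N \/ hsqn X i = ration X.
Proof. by case: X => //= *; try (case: ifP => _); auto. Qed.

Lemma maxn_hsqn X i j : (hsqn X i * (maxn (hsqn X i) (hsqn X j) %/ hsqn X i))%N =
  maxn (hsqn X i) (hsqn X j).
Proof.
rewrite mulnC divnK //; have [->|->] := hsqn_cases X i; first by rewrite dvd1n.
by have [->|->] := hsqn_cases X j; [case: X | rewrite maxnn].
Qed.

Lemma cartn_sym X i j : diagram_ok X ->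
  (i <= affine_rank X)%N -> (j <= affine_rank X)%N ->
  (hsqn X i)%:Z * cartn X i j = (hsqn X j)%:Z * cartn X j i.
Proof.
move=> Xok iN jN; have [->//|ij] := eqVneq i j.
have key : (hsqn X i)%:Z * (maxn (hsqn X i) (hsqn X j) %/ hsqn X i)%:Z =
           (hsqn X j)%:Z * (maxn (hsqn X j) (hsqn X i) %/ hsqn X j)%:Z.
  by rewrite -!PoszM !maxn_hsqn maxnC.
have [/(_ j jN) + _ _] := @Xok i iN; rewrite /local_ok (negbTE ij) /=.
rewrite /cartn (coxn_sym X j i); case: (coxn X i j) => [|[|[|m]]] // _; rewrite /cartm.
- by rewrite !mulrN !(mulrCA _ 2) key.
- by rewrite !mulr0.
- by rewrite !mulrN key.
Qed.

Section Datum.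
Variables (X : affine_type) (Xok : diagram_ok X).
Local Notation I := 'I_(affine_rank X).+1.

Lemma ltn_rank (i : I) : (i <= affine_rank X)%N. Proof. by rewrite -ltnS. Qed.
Hint Resolve ltn_rank : core.

(** Every vertex is joined to s_0 through its ancestors under [parent], along which [depth]
    decreases. *)
Lemma cartn_conn (P : I -> Prop) :
  (forall i j : I, cartn X i j != 0 -> P i -> P j) -> forall i j, P i -> P j.
Proof.
move=> cl.
have sym (i j : I) : cartn X i j != 0 -> cartn X j i != 0.
  move=> ij0; have := cartn_sym Xok (ltn_rank i) (ltn_rank j).
  apply: contra_eqN => /eqP ->; rewrite mulr0 mulf_neq0 //.
  by have [->|->] := hsqn_cases X i; case: X.
have to0 : forall i, (P i <-> P ord0).
  move=> i; move: {2}(depth X i) (leqnn (depth X i)) => b; elim: b i => [|b IH] i le_b.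
    have [i0|i0] := posnP i; first by rewrite (_ : i = ord0) //; exact: val_inj.
    have [_ /andP[_ /implyP/(_ i0)/and3P[_ _ pd]] _] := @Xok _ (ltn_rank i).
    by move: le_b pd; rewrite leqn0 => /eqP ->.
  have [i0|i0] := posnP i; first by rewrite (_ : i = ord0) //; exact: val_inj.
  have [_ /andP[_ /implyP/(_ i0)/and3P[pN pc pd]] _] := @Xok _ (ltn_rank i).
  pose p : I := Ordinal (pN : (parent X i < (affine_rank X).+1)%N).
  have <- : P p <-> P ord0.
    by apply: IH; rewrite -ltnS; exact: leq_trans pd le_b.
  by split; apply: cl; [exact: pc | exact: (sym i p)].
by move=> i j /to0 p0; apply/to0.
Qed.

Lemma datum_sym (i j : I) :
  (hsqn X i)%:Z * cartn X i j = (hsqn X j)%:Z * cartn X j i.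
Proof. exact: cartn_sym. Qed.

Lemma datum_diag (i : I) : cartn X i i = 2.
Proof. by rewrite /cartn /coxn eqxx. Qed.

Lemma datum_bond (i j : I) : i != j ->
  bond_ok (affine_cox i j) (cartn X i j) (cartn X j i).
Proof.
move=> ij; rewrite affine_coxE; have [/(_ j (ltn_rank j)) + _ _] := @Xok _ (ltn_rank i).
by rewrite /local_ok val_eqE (negbTE ij).
Qed.

Lemma datum_ratio : 0 < (ration X)%:Z. Proof. by case: X. Qed.

Lemma datum_hsq (i : I) : (hsqn X i)%:Z = 1 \/ (hsqn X i)%:Z = (ration X)%:Z.
Proof. by have [->|->] := hsqn_cases X i; [left | right]. Qed.

Lemma datum_mark (i : I) : 0 < (markn X i)%:Z.
Proof.
rewrite ltz_nat; have := ltn_rank i; case: X i => [n|n|n|n|||||] [i /= _] //=; try by case: ifP.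
all: by do 9?[case: i => [//|i]].
Qed.

Lemma datum_mark0 : (markn X (ord0 : I))%:Z = 1.
Proof. by case: X. Qed.

Lemma datum_null (i : I) : \sum_(j : I) cartn X i j * (markn X j)%:Z = 0.
Proof. by have [_ _ /eqP] := @Xok _ (ltn_rank i). Qed.

Lemma datum_dvd (i : I) : ((ration X)%:Z %| (hsqn X i)%:Z * (markn X i)%:Z)%Z.
Proof. by have [_ /andP[]] := @Xok _ (ltn_rank i); rewrite -PoszM dvdzE. Qed.

Definition affine_datum_of : affine_datum (@affine_cox X) :=
  @AffineDatum (affine_rank X) (@affine_cox X) (fun i j => cartn X i j)
    (fun i => (hsqn X i)%:Z) (fun i => (markn X i)%:Z) (ration X)%:Z
    datum_diag datum_sym datum_bond cartn_conn datum_ratio datum_hsq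
    datum_mark datum_mark0 datum_null datum_dvd.

End Datum.

(** * Type I and Type II segments *)

Lemma one_neq_two : 1 <> 2 :> int. Proof. by []. Qed.

Section TypeI.
Variables (n : nat) (M : 'I_n.+1 -> 'I_n.+1 -> nat) (C : affine_datum M).
Hypothesis long0 : hsq C ord0 = sqratio C.
Local Notation V := 'rV[int]_n.+1.
Local Notation s0 := (cox_gen M ord0).
Implicit Types (v : V) (w : coxgroup M).

Let top : V := delta C - sroot ord0.
(** The sign comes from alpha_0 = delta - top, with delta in the radical of the form. *)
Let deg v : int := - copair C ord0 v.

Lemma gradingI_top0 : top 0 ord0 = 0.
Proof. by rewrite /top !mxE mark0 subrr. Qed.

Lemma gradingI_topL : inL C (sqratio C) top.
Proof.
apply: inLD; first by apply: inL_delta; right.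
apply: inLN => j; rewrite srootE; case: eqP => [<-|_]; last by rewrite mulr0 dvdz0.
by rewrite long0 mulr1.
Qed.

Lemma gradingI_form v : aform C v top = sqratio C * 1 * deg v.
Proof.
by rewrite /top !aformL aform_delta aformC aform_sroot long0 /deg; ring.
Qed.

Lemma gradingI_deg_top : deg top = 2.
Proof.
rewrite /deg /top copairD -scaleN1r copairZ copair_delta copair_sroot cart_diag.
by [].
Qed.

Lemma gradingI_deg_sroot k : Sfin k -> 0 <= deg (sroot k).
Proof.
move=> Sk; rewrite /deg copair_sroot oppr_ge0 cart_le0 //.
by apply: contraTneq Sk => <-.
Qed.

Lemma gradingI_tau0 v : refl C ord0 v 0 ord0 = v 0 ord0 + deg v.
Proof. by rewrite /refl !mxE eqxx mulr1. Qed.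

Lemma gradingI_deg_tau v : deg (refl C ord0 v) = - deg v.
Proof.
rewrite /deg /refl -scaleNr copairD copairZ copair_sroot cart_diag; ring.
Qed.

Lemma gradingI_J k : Sfin k -> deg (sroot k) = 0 ->
  exists l, [/\ Sfin l, deg (sroot l) = 0 & refl C ord0 (sroot k) = sroot l].
Proof.
move=> Sk dk; exists k; split=> //; rewrite /refl.
by move/eqP: dk; rewrite oppr_eq0 => /eqP ->; rewrite scale0r subr0.
Qed.

Lemma gradingI_act w v :
  vpos (cox_act C (w * s0)%g v) <-> vpos (cox_act C w (refl C ord0 v)).
Proof. by rewrite cox_actM cox_act_gen. Qed.

Lemma gradingI_tau1 v : refl C ord0 v = v + deg v *: (delta C - top).
Proof. by rewrite /top subKr /deg scaleNr. Qed.

Definition gradingI : grading C :=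
  @Grading n M C 1 top deg (refl C ord0) (fun w => w * s0)%g
    (or_introl erefl) gradingI_top0 gradingI_topL gradingI_form gradingI_deg_top
    gradingI_deg_sroot (refl_is_linear C ord0) (reflK C ord0) (refl_delta C ord0)
    (@aroot_refl _ _ C ord0) gradingI_tau0 gradingI_deg_tau gradingI_J
    (fun w => cox_mulgenK w ord0) gradingI_act (fun _ => gradingI_tau1)
    (fun _ => esym (subKr _ _)) (fun _ _ => erefl)
    (fun e => False_ind _ (one_neq_two e))
    (fun e => False_ind _ (one_neq_two e)).

Lemma gradingI_eps : eps gradingI = 1%N. Proof. by []. Qed.

Lemma cox_gen_commute k : Sfin k ->
  (cox_gen M k * s0 = s0 * cox_gen M k)%g <-> deg (sroot k) = 0.
Proof.
move=> Sk; have k0 : k != ord0 by apply: contraTneq Sk => ->.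
rewrite /deg copair_sroot; split=> [e|/eqP].
  (* The two products send alpha_k to vectors whose coordinates at s_0 are -a_0k and a_0k. *)
  have := congr1 (fun w => cox_act C w (sroot k) 0 ord0) e.
  have kE : refl C k (sroot k) = - sroot k.
    by rewrite /refl copair_sroot cart_diag; apply/rowP => j; rewrite !mxE; ring.
  have k0E (y : V) : refl C k y 0 ord0 = y 0 ord0.
    by rewrite /refl !mxE eqxx [ord0 == k]eq_sym (negbTE k0) mulr0 subr0.
  rewrite /= !cox_actM !cox_act_gen k0E kE linearN mxE /refl !copair_sroot.
  rewrite !mxE eqxx [ord0 == k]eq_sym (negbTE k0) /= ?copair_sroot.
  by move: (cart C ord0 k) => x; lia.
rewrite oppr_eq0 => /eqP a0; have := cart_bond C k0; have := cart_sym C k ord0.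
rewrite a0 mulr0 => /eqP; rewrite mulf_eq0 gt_eqF ?hsq_gt0 //= => /eqP ->.
rewrite /bond_ok !inE; do 6?[case/orP]; case/eqP => // M2.
have := cox_braid M k ord0; rewrite [M k ord0]M2 /=.
by rewrite (cox_word_cat M [:: k] [:: ord0]) (cox_word_cat M [:: ord0] [:: k]).
Qed.

End TypeI.

Section TypeII.
Variables (n : nat) (M : 'I_n.+1 -> 'I_n.+1 -> nat) (C : affine_datum M).
Variable th : {perm 'I_n.+1}.
Hypothesis th_aut : diagram_aut M th.
Hypothesis thK : involutive th.
Hypothesis th_cart : forall i j, cart C (th i) (th j) = cart C i j.
Hypothesis th_hsq : forall i, hsq C (th i) = hsq C i.
Hypothesis long0 : hsq C ord0 = sqratio C.
Local Notation i1 := (th ord0).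
Hypothesis th0 : i1 != ord0.
Hypothesis cart01 : cart C ord0 i1 = 0.
Hypothesis cart_twin : forall k, k != ord0 -> k != i1 -> cart C i1 k = cart C ord0 k.
Hypothesis mark1 : mark C i1 = 1.
Local Notation I := 'I_n.+1.
Local Notation V := 'rV[int]_n.+1.
Implicit Types (v : V) (w : coxgroup M).

Let top : V := delta C + (sroot i1 - sroot ord0).
Let deg v : int := v 0 i1 - v 0 ord0.
Let tau v : V := \row_i v 0 (th i).

Lemma th_inj i j : (th i == th j) = (i == j).
Proof. exact: inj_eq perm_inj _ _. Qed.

Lemma twist_linear : linear tau.
Proof. by move=> c x y; apply/rowP => i; rewrite !mxE. Qed.

Lemma twistK : involutive tau.
Proof. by move=> v; apply/rowP => i; rewrite !mxE thK. Qed.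

Lemma twist_sroot k : tau (sroot k) = sroot (th k).
Proof. by apply/rowP => i; rewrite mxE !srootE -th_inj thK. Qed.

Lemma twist_copair i v : copair C (th i) (tau v) = copair C i v.
Proof.
rewrite /copair (reindex_inj (@perm_inj _ th)); apply: eq_bigr => j _.
by rewrite th_cart mxE thK.
Qed.

Lemma twist_refl i v : refl C (th i) (tau v) = tau (refl C i v).
Proof.
rewrite /refl twist_copair -twist_sroot; apply/rowP => j; rewrite !mxE; ring.
Qed.

Lemma twist_form x y : aform C (tau x) (tau y) = aform C x y.
Proof.
rewrite /aform (reindex_inj (@perm_inj _ th)); apply: eq_bigr => j _.
by rewrite th_hsq twist_copair mxE thK.
Qed.

Lemma twist_delta : tau (delta C) = delta C.
Proof.
(* The twist of delta has norm 0, hence is a multiple of delta; the coordinate at s_0 shows that the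
   factor is 1. *)
have := aform_eq0 (x := tau (delta C)) (C := C).
rewrite twist_form aform_delta => /(_ erefl) ->.
by rewrite !mxE mark1 scale1r.
Qed.

Lemma twist_root v : aroot C v -> aroot C (tau v).
Proof.
case=> e [e1 fv ev]; exists e; split=> //; first by rewrite twist_form.
by move=> i; rewrite mxE -th_hsq; exact: ev.
Qed.

Lemma twist_pos v : vpos (tau v) <-> vpos v.
Proof.
split=> pv i; last by rewrite mxE.
by have := pv (th i); rewrite mxE thK.
Qed.

Lemma cox_map_word s : cox_map th (cox_word M s) = cox_word M (map th s).
Proof. by rewrite cox_mapE // -(big_map th xpredT (cox_gen M)) cox_prodE. Qed.

Lemma cox_mapK : involutive (@cox_map _ M th).
Proof.
move=> w; rewrite -(cox_wordK w) !cox_map_word mapK //.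
Qed.

Lemma cox_map_act w v : cox_act C (cox_map th w) v = tau (cox_act C w (tau v)).
Proof.
rewrite -(cox_wordK w) cox_map_word !cox_act_word.
elim: (repr w) => [|i s IH] /=; first by rewrite twistK.
by rewrite IH twist_refl.
Qed.

Lemma cox_map_len w : cox_len (cox_map th w) = cox_len w.
Proof.
have le (y : coxgroup M) : (cox_len (cox_map th y) <= cox_len y)%N.
  case: (cox_len_word y) => s <- <-.
  by rewrite (cox_map_word s) -(size_map th) cox_len_le.
by apply/eqP; rewrite eqn_leq le -{1}[w]cox_mapK le.
Qed.

Lemma gradingII_top0 : top 0 ord0 = 0.
Proof. by rewrite /top !mxE mark0 eqxx eq_sym (negbTE th0). Qed.

Lemma gradingII_topL : inL C (sqratio C) top.
Proof.
have Ls i : hsq C i = sqratio C -> inL C (sqratio C) (sroot i).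
  move=> di j; rewrite srootE; case: eqP => [<-|_]; last by rewrite mulr0 dvdz0.
  by rewrite di mulr1.
apply: inLD; first by apply: inL_delta; right.
by apply: inLD; [|apply: inLN]; apply: Ls; rewrite ?th_hsq.
Qed.

(** The vertices 0 and i1 have the same Cartan entries towards all others, so the difference of
    their coroots sees only the two coordinates themselves. *)
Lemma copair_twin v : copair C i1 v - copair C ord0 v = 2 * deg v.
Proof.
rewrite /copair -sumrB (bigD1 ord0) //= (bigD1 i1) //= big1.
  have c10 : cart C i1 ord0 = 0 by have := th_cart ord0 i1; rewrite thK cart01.
  by rewrite !cart_diag cart01 c10 /deg; ring.
by move=> k /andP[k0 k1]; rewrite cart_twin // subrr.
Qed.

Lemma gradingII_form v : aform C v top = sqratio C * 2 * deg v.
Proof.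
rewrite /top !aformL aform_delta !(aformC _ v) !aform_sroot th_hsq long0 add0r.
by rewrite -mulrBr copair_twin; ring.
Qed.

Lemma gradingII_deg_top : deg top = 2.
Proof.
rewrite /deg gradingII_top0 /top !mxE mark1 !eqxx (negbTE th0) /=; ring.
Qed.

Lemma gradingII_deg_sroot k : Sfin k -> 0 <= deg (sroot k).
Proof.
move=> Sk; rewrite /deg !srootE; case: (k =P ord0) Sk => [->//|_ _].
by rewrite subr0; case: eqP.
Qed.

Lemma deg_sroot_eq0 k : Sfin k -> deg (sroot k) = 0 <-> k != i1.
Proof.
move=> Sk; rewrite /deg !srootE; case: (k =P ord0) Sk => [->//|_ _].
by case: eqP => // _; split.
Qed.

Lemma gradingII_tau0 v : tau v 0 ord0 = v 0 ord0 + deg v.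
Proof. by rewrite mxE /deg addrC subrK. Qed.

Lemma gradingII_deg_tau v : deg (tau v) = - deg v.
Proof. by rewrite /deg !mxE thK opprB. Qed.

Lemma SfinE (k : I) : Sfin k = (k != ord0).
Proof. by rewrite /Sfin lt0n. Qed.

Lemma gradingII_J k : Sfin k -> deg (sroot k) = 0 ->
  exists l, [/\ Sfin l, deg (sroot l) = 0 & tau (sroot k) = sroot l].
Proof.
move=> Sk /(deg_sroot_eq0 Sk) k1; exists (th k).
have Sl : Sfin (th k) by rewrite SfinE -th_inj thK.
split=> //; last exact: twist_sroot.
by apply/(deg_sroot_eq0 Sl); rewrite th_inj -SfinE.
Qed.

Lemma gradingII_act w v :
  vpos (cox_act C (cox_map th w) v) <-> vpos (cox_act C w (tau v)).
Proof. by rewrite cox_map_act twist_pos. Qed.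

Lemma gradingII_tau2 : exists2 k, Sfin k & tau (sroot k) = sroot ord0.
Proof. by exists i1; rewrite ?SfinE // twist_sroot thK. Qed.

Definition gradingII : grading C :=
  @Grading n M C 2 top deg tau (cox_map th)
    (or_intror erefl) gradingII_top0 gradingII_topL gradingII_form gradingII_deg_top
    gradingII_deg_sroot twist_linear twistK twist_delta
    twist_root gradingII_tau0 gradingII_deg_tau gradingII_J
    cox_mapK gradingII_act
    (fun e => False_ind _ (one_neq_two (esym e)))
    (fun e => False_ind _ (one_neq_two (esym e)))
    (fun e => False_ind _ (one_neq_two (esym e)))
    (fun _ => cox_map_len) (fun _ => gradingII_tau2).

Lemma cox_map_par_fact (K K' : pred I) w : (forall i, K' (th i) = K i) ->
  u_part K' (cox_map th w) = cox_map th (u_part K w) /\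
  v_part K' (cox_map th w) = cox_map th (v_part K w).
Proof.
move=> KK'; have [mu Pv wE _] := par_partP C K w.
set u := u_part K w in mu wE *; set v := v_part K w in Pv wE *.
have mu' : min_rep M K' (cox_map th u).
  apply/(min_repP C) => k Kk; apply/gradingII_act; rewrite twist_sroot.
  by apply: ((min_repP C _ _).1 mu); rewrite -KK' thK.
have Pv' : parabolic M K' (cox_map th v).
  case: Pv => s Ks ->; rewrite cox_prodE cox_map_word -cox_prodE.
  exists (map th s) => //; rewrite all_map; apply: sub_all Ks => i /=.
  by rewrite KK'.
by rewrite wE cox_mapM // (u_partE C) // (v_partE C).
Qed.

End TypeII.

(** * Identification of the common recursion with the definitions of the two types *)

Lemma affine_partitions_ext (sg sg' : cpart -> Prop) (al al' : cpart -> cpart -> Prop) :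
  (forall a, sg a <-> sg' a) -> (forall a b, al a b <-> al' a b) ->
  affine_partitions sg al = affine_partitions sg' al'.
Proof.
move=> sgE alE; have -> : sg = sg' by apply/funext => a; apply/propext.
by have -> : al = al' by apply/funext => a; apply/funext => b; apply/propext.
Qed.

Lemma long0_of X : affine_ok X -> hsqn X 0 = ration X.
Proof. by case: X => //= -[]. Qed.

Section BijectionI.
Variables (X : affine_type) (hX : affine_ok X) (f : nat -> seq (affW X)).
Hypothesis fP : enumI f.
Let C := affine_datum_of (affine_diagram_ok hX).

Lemma long0_datum : hsq C ord0 = sqratio C.
Proof. by rewrite /= long0_of. Qed.
Let D := gradingI long0_datum.

Lemma WJ_I x : WJ D x <->
  (parabolic (@affine_cox X) (@S_ X) `&` min_rep (@affine_cox X) (@J1_ X))%classic x.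
Proof.
split=> [[Px Jx]|[Px Jx]]; split=> //.
  apply/(min_repP C) => k /andP[Sk /eqP /(cox_gen_commute long0_datum Sk)]; exact: Jx.
move=> k Sk /(cox_gen_commute long0_datum Sk) ck; apply: ((min_repP C _ _).1 Jx).
by apply/andP; split=> //; apply/eqP.
Qed.

Lemma piI_fact w : piI f w = fact D f (cox_len w) w.
Proof.
rewrite /piI; move: (cox_len w) => k; elim: k w => //= k IH w.
by rewrite IH /enc gradingI_eps addn1.
Qed.

Lemma partsI_E : partsI f = affine_partitions (seg D f) (allow D f).
Proof.
apply: affine_partitions_ext => [a|a b].
  by rewrite /is_segI /seg gradingI_eps subn1.
by rewrite /allowedI /allow /segI /dcd gradingI_eps !subn1 /= mulgA.
Qed.

Lemma partsI_bij :
  set_bij (@affWS X) (partsI f) (piI f) /\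
  (forall w : affW X, affWS w -> (\sum_(a <- piI f w) a.1)%N = cox_len w).
Proof.
apply: (fact_bij (D := D) (f := f) _ piI_fact partsI_E) => j.
have [uf ff] := fP j; split=> // x; rewrite ff; split=> -[Jx lx]; split=> //.
  exact/WJ_I.
exact/WJ_I.
Qed.

End BijectionI.

(** * Diagram automorphisms exchanging s_0 and s_1 *)

Section Twin.
Local Open Scope nat_scope.

(* s_2, ..., s_m is the maximal path fixed pointwise by every automorphism
   exchanging s_0 and s_1; at most two vertices remain. *)
Record twin X (m : nat) : Prop := Twin {
  twin_m : m <= affine_rank X <= m + 2;
  twin_02 : coxn X 0 2 = 3;
  twin_01 : coxn X 0 1 = 2;
  twin_1 : forall t, t <= affine_rank X -> coxn X 1 t = 3 -> t = 2;
  twin_path : forall k, 2 <= k < m -> coxn X k k.+1 <> 2;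
  twin_next : forall k t, 2 <= k < m -> k < t <= affine_rank X ->
    coxn X k t <> 2 -> t = k.+1;
  twin_swap : forall k, 1 < k -> coxn X 1 k = coxn X 0 k;
  twin_hsq : forall i j, i <= affine_rank X -> j <= affine_rank X ->
    (i < 2) = (j < 2) -> (2 <= i <= m -> i = j) -> hsqn X i = hsqn X j;
  twin_mark : markn X 1 = 1
}.

Lemma twinB n : 2 < n -> twin (affB n) n.
Proof.
move=> n2; split.
- by rewrite /=; lia.
- by rewrite coxnB; ifd.
- by rewrite coxnB; ifd.
- by move=> t /= tn; rewrite coxnB; ifs; lia.
- by move=> k kn; rewrite coxnB; ifs.
- by move=> k t /= kn tn; rewrite coxnB; ifs; lia.
- by move=> k k1; rewrite !coxnB; ifs.
- by move=> i j /= iN jN ij ij'; ifs; lia.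
- by [].
Qed.

Lemma twinD n : 3 < n -> twin (affD n) n.-2.
Proof.
move=> n2; split.
- by rewrite /=; lia.
- by rewrite coxnD; ifd.
- by rewrite coxnD; ifd.
- by move=> t /= tn; rewrite coxnD; ifs; lia.
- by move=> k kn; rewrite coxnD; ifs.
- by move=> k t /= kn tn; rewrite coxnD; ifs; lia.
- by move=> k k1; rewrite !coxnD; ifs.
- by [].
- by [].
Qed.

End Twin.

Section BijectionII.
Variables (X : affine_type) (hX : affine_ok X) (f : nat -> seq (affW X)).
Variables (m : nat) (Xm : twin X m) (th : {perm 'I_(affine_rank X).+1}).
Hypotheses (fP : enumII f) (thP : swap_aut th).
Let C := affine_datum_of (affine_diagram_ok hX).
Local Notation I := 'I_(affine_rank X).+1.

Lemma th_aut : diagram_aut (@affine_cox X) th. Proof. by case: thP. Qed.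
Lemma th_ord0 : th ord0 = 1%N :> nat. Proof. by case: thP. Qed.
Lemma th_one (i : I) : i = 1%N :> nat -> th i = ord0.
Proof. by case: thP => _ _ + _; apply. Qed.
Lemma th_gt1 (i : I) : (1 < th i)%N = (1 < i)%N.
Proof. by case: thP => _ _ _ /(_ i). Qed.

Lemma th_coxn (i j : I) : coxn X (th i) (th j) = coxn X i j.
Proof. by rewrite -!affine_coxE th_aut. Qed.

(** Propagation along the path: s_2 goes to the only neighbour of s_1, and each next vertex to a
    later neighbour of a fixed one, which is unique. *)
Lemma th_fix (i : I) : (2 <= i <= m)%N -> th i = i.
Proof.
have rk := twin_m Xm.
move: {2}(val i) (leqnn i) => k; elim: k i => [|k IH] i le_ik /andP[i2 im]; first by lia.
have [lt_ik|eq_ik] : (i <= k)%N \/ i = k.+1 :> nat by lia.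
  by apply: IH => //; rewrite i2.
have iN := ltn_rank i; apply: val_inj => /=; rewrite eq_ik.
have [k1|k1] : k = 1%N \/ (2 <= k)%N by lia.
  rewrite k1; apply: (twin_1 Xm); first exact: ltn_rank.
  by have := th_coxn ord0 i; rewrite th_ord0 eq_ik k1 => ->; exact: twin_02 Xm.
have kN : (k < (affine_rank X).+1)%N by lia.
pose j : I := Ordinal kN; have jE : th j = j by apply: IH => //=; lia.
apply: (twin_next Xm) => //=; first by lia.
  rewrite ltn_rank andbT ltnNge; apply/negP => le_tk.
  have t2 : (1 < th i)%N by rewrite th_gt1.
  have e : th (th i) = th i.
    by apply: IH => //; rewrite t2; apply: leq_trans le_tk _; rewrite ltnW // -eq_ik.
  by move/perm_inj: e => e; move: le_tk; rewrite e eq_ik ltnn.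
have -> : k = th j :> nat by rewrite jE.
by rewrite th_coxn eq_ik; apply: (twin_path Xm); rewrite k1 -eq_ik.
Qed.

Lemma th_gtm (i : I) : (m < i)%N -> (1 < i)%N -> (m < th i)%N.
Proof.
move=> mi i1; rewrite ltnNge; apply/negP => tm.
have e : th (th i) = th i by apply: th_fix; rewrite th_gt1 i1.
by move/perm_inj: e => e; move: tm; rewrite e leqNgt mi.
Qed.

(** Being an involution is not part of [swap_aut]. Off s_0, s_1 and the fixed path at most two
    vertices remain, so the square is trivial there as well. *)
Lemma th_invol : involutive th.
Proof.
move=> i; have rk := twin_m Xm.
have [i0|[i1|[im|im]]] : i = 0%N :> nat \/ i = 1%N :> nat \/ (2 <= i <= m)%N \/
    (m < i)%N /\ (1 < i)%N by lia.
- have -> : i = ord0 by apply: val_inj.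
  by apply: th_one; exact: th_ord0.
- by rewrite (th_one i1); apply: val_inj; rewrite /= th_ord0 i1.
- by rewrite !th_fix.
have [mi i1] := im; have t1 : (1 < th i)%N by rewrite th_gt1.
have tm := th_gtm mi i1; have tm' := th_gtm tm t1.
have [e|ne] := eqVneq (th i) i; first by rewrite !e.
have ne' : th (th i) != th i by rewrite (inj_eq perm_inj).
apply: val_inj => /=; move: ne ne'; rewrite -!val_eqE /=.
have := ltn_rank (th (th i)); have := ltn_rank (th i); have := ltn_rank i; lia.
Qed.

Lemma th_hsqn (i : I) : hsqn X (th i) = hsqn X i.
Proof.
apply/esym; apply: (twin_hsq Xm); try exact: ltn_rank.
  by rewrite !(ltnNge _ 2) th_gt1.
by move/th_fix ->.
Qed.

Lemma datum_th_cart (i j : I) : cart C (th i) (th j) = cart C i j.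
Proof. by rewrite /= /cartn th_coxn !th_hsqn. Qed.

Lemma datum_th_hsq (i : I) : hsq C (th i) = hsq C i.
Proof. by rewrite /= th_hsqn. Qed.

Lemma datum_th0 : th ord0 != ord0.
Proof. by rewrite -val_eqE /= th_ord0. Qed.

Lemma datum_cart01 : cart C ord0 (th ord0) = 0.
Proof. by rewrite /= /cartn th_ord0 (twin_01 Xm). Qed.

Lemma hsqn01 : hsqn X 1 = hsqn X 0.
Proof. by have := th_hsqn ord0; rewrite th_ord0. Qed.

Lemma datum_cart_twin (k : I) : k != ord0 -> k != th ord0 ->
  cart C (th ord0) k = cart C ord0 k.
Proof.
rewrite -!val_eqE /= th_ord0 => k0 k1.
by rewrite /cartn (twin_swap Xm) ?hsqn01 //; lia.
Qed.

Lemma datum_mark1 : mark C (th ord0) = 1.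
Proof. by rewrite /= th_ord0 (twin_mark Xm). Qed.

Let D := gradingII th_aut th_invol datum_th_cart datum_th_hsq (long0_datum hX)
  datum_th0 datum_cart01 datum_cart_twin datum_mark1.

Lemma WJ_II x : WJ D x <->
  (parabolic (@affine_cox X) (@S_ X) `&` min_rep (@affine_cox X) (@J2_ X))%classic x.
Proof.
have J2E (k : I) : J2_ k <-> Sfin k /\ deg D (sroot k) = 0.
  rewrite /J2_ /Sfin; split=> [k1|[k0 /(deg_sroot_eq0 _ k0)]].
    have k0 : (0 < k)%N by lia.
    split=> //; apply/(deg_sroot_eq0 _ k0).
    by rewrite -val_eqE /= th_ord0; lia.
  by rewrite -val_eqE /= th_ord0; lia.
split=> [[Px Jx]|[Px Jx]]; split=> //.
  by apply/(min_repP C) => k /J2E[]; exact: Jx.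
by move=> k Sk dk; apply: ((min_repP C _ _).1 Jx); apply/J2E.
Qed.

Lemma S'_th (i : I) : S'_ (th i) = Sfin i.
Proof.
by rewrite SfinE -(inj_eq (@perm_inj _ th)) -val_eqE /= th_ord0.
Qed.

(** On turns that split off a 1-segment, [factII] holds the twist of the element that [fact] holds;
    this is why the two statements go through one induction. *)
Lemma factII_fact k (w : affW X) :
  factII f th k false w = fact D f k w /\
  factII f th k true w = fact D f k (cox_map th w).
Proof.
have mapK := cox_mapK th_aut th_invol.
elim: k w => [//|k IH] w.
have map1 : (cox_map th w == 1%g) = (w == 1%g).
  have e1 : cox_map th (1 : affW X)%g = 1%g.
    by rewrite -[in LHS]cox_word0 (cox_map_word th_aut).
  by rewrite -(inj_eq (inv_inj mapK) w) e1.
split.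
  rewrite /=; case: eqP => // _.
  have [uE vE] := cox_map_par_fact th_aut th_invol datum_th_cart (cox_map th w) S'_th.
  rewrite mapK in uE vE; rewrite uE vE.
  have [_ ->] := IH (cox_map th (u_part Sfin (cox_map th w))); rewrite mapK; congr (_ :: _).
  rewrite (cox_map_len th_aut th_invol) /enc addn0; congr (_, _.+1).
  by rewrite index_map //; exact: inv_inj.
rewrite /= map1; case: eqP => // _; rewrite mapK.
have [-> _] := IH (u_part (@S_ X) w).
by rewrite /enc addn0.
Qed.

Lemma piII_fact w : piII f th w = fact D f (cox_len w) w.
Proof. by have [] := factII_fact (cox_len w) w. Qed.

Lemma partsII_E : partsII f th = affine_partitions (seg D f) (allow D f).
Proof.
apply: affine_partitions_ext => [a|a b].
  by rewrite /is_segII /seg /= subn0; split=> [//|[]].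
rewrite /allowedII /allow /segII /dcd /f_ /= !subn0.
(* Out of range both sides are the default 1, which the automorphism fixes, so this holds for an
   arbitrary b. *)
have -> : nth 1%g [seq cox_map th x | x <- f b.1] b.2.-1 =
    cox_map th (nth 1%g (f b.1) b.2.-1).
  have [lt_b|le_b] := ltnP b.2.-1 (size (f b.1)); first exact: nth_map.
  rewrite !nth_default ?size_map //.
  by rewrite -[in RHS]cox_word0 (cox_map_word th_aut).
by rewrite (cox_mapM th_aut) (cox_mapK th_aut th_invol).
Qed.

Lemma partsII_bij :
  set_bij (@affWS X) (partsII f th) (piII f th) /\
  (forall w : affW X, affWS w -> (\sum_(a <- piII f th w) a.1)%N = cox_len w).
Proof.
apply: (fact_bij (D := D) (f := f) _ piII_fact partsII_E) => j.
have [uf ff] := fP j; split=> // x; rewrite ff; split=> -[Jx lx]; split=> //.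
  exact/WJ_II.
exact/WJ_II.
Qed.

End BijectionII.

Theorem theorem3p5 (X : affine_type) (hX : affine_ok X) :
  (~~ is_typeII X ->
     forall f : nat -> seq (affW X), enumI f ->
       set_bij (@affWS X) (partsI f) (piI f) /\
       (forall w : affW X, affWS w ->
          (\sum_(a <- piI f w) a.1)%N = cox_len w)) /\
  (is_typeII X ->
     forall (f : nat -> seq (affW X)) (th : {perm 'I_(affine_rank X).+1}),
       enumII f -> swap_aut th ->
       set_bij (@affWS X) (partsII f th) (piII f th) /\
       (forall w : affW X, affWS w ->
          (\sum_(a <- piII f th w) a.1)%N = cox_len w)).
Proof.
split=> [_ f fP | XII f th fP thP]; first exact: partsI_bij.
have [m Xm] : exists m, twin X m.
  case: X hX XII {f th fP thP} => // n n_ok _; first by exists n; exact: twinB.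
  by exists n.-2; exact: twinD.
exact: partsII_bij Xm _ fP thP.
Qed.
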